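(* Let $M$ be an ACT-R model whose rules are in set normal form, let $\sigma,\sigma'$ be abstract ACT-R states, and let $\mathrm{chr}(M)$, $\mathrm{chr}(\sigma)$, $\mathrm{chr}(\sigma')$ be their CHR translations. Then the following are equivalent: (1) $\sigma \rightarrowtail \sigma'$ in the abstract operational semantics of ACT-R for the model $M$ (i.e. by an apply transition of some rule of $M$ or by a no-rule transition); (2) $[\mathrm{chr}(\sigma)] \mapsto [\mathrm{chr}(\sigma')]$ in the CHR operational semantics for the program $\mathrm{chr}(M)$.
   Context: ACT-R setting. Fix disjoint sets of constants $\mathcal{C}$ and variables $\mathcal{V}$, a finite set of buffers $\mathbb{B}\subseteq\mathcal{C}$, a set of types $\mathbb{T}\subseteq\mathcal{C}$ and a typing function $\tau$ assigning to each type a finite set of slot names in $\mathcal{C}$, with a type $\mathtt{chunk}\in\mathbb{T}$, $\tau(\mathtt{chunk})=\emptyset$. A chunk store $\Delta$ is a multiset of chunks $c=(t,\mathrm{val})$, $t\in\mathbb{T}$, $\mathrm{val}:\tau(t)\to\Delta$, containing $\mathtt{nil}=(\mathtt{chunk},\emptyset)$, with an injective identifier function $\mathrm{id}_\Delta:\Delta\to\mathcal{C}$; $\mathrm{id}^{-1}_\Delta(x)$ is the chunk with identifier $x$ if it exists, else $\mathtt{nil}$. A partial chunk store referring to $\Delta$ is a multiset of chunks $(t,\mathrm{val})$ with values in $\Delta$ or in itself and identifiers disjoint from those of $\Delta$. A fixed chunk merging operator $\circ$ on (partial) chunk stores is associative, has $\emptyset$ as neutral element, requires chunks with equal identifiers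 in both arguments to be equal, absorbs common parts (if $X\subseteq\Delta'$ and $X\subseteq\Delta''$ then there are $Y,Z$ with $\Delta'\circ\Delta''=X\circ Y\circ Z$, $\Delta'=X\circ Y$, $\Delta''=X\circ Z$), satisfies $\Delta'\subseteq\Delta'\circ\Delta''$ with identifiers preserved, and comes with a map $\mathrm{map}_{\Delta',\Delta''}:\Delta'\uplus\Delta''\to\Delta'\circ\Delta''$ that is the identity on $\Delta'$. An abstract state is $\sigma=\langle\Delta;\gamma;\upsilon\rangle$ with $\Delta$ a chunk store, $\gamma:\mathbb{B}\to\Delta\times\mathbb{R}_{\ge0}$ (chunk and delay per buffer), $\upsilon$ a conjunction of ground atoms (additional information). A rule is $L\Rightarrow R$: $L$ a finite set of buffer tests $\mathrm{test}(b,t,P)$ with $b\in\mathbb{B}$, $t\in\mathbb{T}$, $P\subseteq\mathcal{C}\times(\mathcal{C}\cup\mathcal{V})$ slot–value pairs; $R$ a finite set of actions $a(b,t,P)$ with $a\in\{=,+\}$ (modification, request), at most one action per buffer, and $\mathrm{vars}(R)\subseteq\mathrm{vars}(L)$. The rule is in set normal form if for every test $\mathrm{test}(b,t,P)\in L$ and every $s\in\tau(t)$ there is exactly one $v$ with $(s,v)\in P$. A rule $r$ matches $\sigma$ ($r\sqsubseteq\sigma$) if there is a substitution $\theta$ such that for every test $\mathrm{test}(b,t,P)\in L$: $\gamma(b)=((t,\mathrm{val}),0)$ and $\mathrm{id}_\Delta(\mathrm{val}(s))=v\theta$ for all $(s,v)\in P$; $\mathrm{Bindings}(r,\sigma)$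 is the smallest such $\theta$. Action interpretations: for $\sigma=\langle\Delta;\gamma;\upsilon\rangle$ with $\gamma(b)=((t,\mathrm{val}_\gamma),d)$, $I(=(b,t,P),\sigma)=\{(\{c\},\gamma^*,\mathrm{true})\}$ where $c=(t,\mathrm{val}_b)$ has a fresh identifier, $\gamma^*$ is defined only at $b$ with $\gamma^*(b)=(c,0)$, and $\mathrm{val}_b(s)=\mathrm{id}^{-1}_\Delta(v)$ if $(s,v)\in P$, else $\mathrm{val}_\gamma(s)$. For each buffer $b$ an architecture-given function $\mathrm{request}_b(t,P,\upsilon)$ returns a set of triples $(c^*,d^*,\upsilon^* )$; $I(+(b,t,P),\sigma)$ consists of $(\{c^*\},\gamma^*,\upsilon^* )$ with $\gamma^*$ defined only at $b$, $\gamma^*(b)=(c^*,1)$ if $d^*>0$ and $(c^*,0)$ otherwise, for each such triple. Effects combine by $(\Delta',\gamma',\upsilon')\sqcup(\Delta'',\gamma'',\upsilon'')=(\Delta'\circ\Delta'',\gamma,\upsilon'\wedge\upsilon'')$ where $\gamma(b)$ is $\gamma'(b)$ resp. $\gamma''(b)$ with the chunk replaced by its image under $\mathrm{map}_{\Delta',\Delta''}$; for sets $E\sqcup F=\{e\sqcup f\mid e\in E,f\in F\}$. For a rule $r=L\Rightarrow R$, $I(r,\sigma)=\bigsqcup_{\alpha\in R}I(\alpha,\sigma)$ (result stores renamed apart). Transitions: (apply) if $r\sqsubseteq\sigma$, $\theta=\mathrm{Bindings}(r,\sigma)$, $(\Delta^*,\gamma^*,\upsilon^* )\in I(r\theta,\sigma)$,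 then $\sigma\rightarrowtail^r\langle\Delta\circ\Delta^*;\gamma';\upsilon\wedge\upsilon^*\rangle$ with $\gamma'(b)=(\mathrm{map}_{\Delta,\Delta^*}(c),d)$ if $\gamma^*(b)=(c,d)$ is defined and $\gamma'(b)=\gamma(b)$ otherwise; (no rule) if $\gamma(b^* )=(c^*,d^* )$ with $d^*>0$ then $\sigma\rightarrowtail_{\mathrm{no}}\langle\Delta;\gamma';\upsilon\rangle$ with $\gamma'(b^* )=(c^*,0)$ and $\gamma'(b)=\gamma(b)$ otherwise. $\rightarrowtail$ is the union of these transitions. CHR. A CHR state is $\langle\mathbb{G};\mathbb{B};\mathbb{V}\rangle$ ($\mathbb{G}$ multiset of constraints, $\mathbb{B}$ conjunction of built-in constraints, $\mathbb{V}$ global variables). State equivalence $\equiv$ is the smallest equivalence with: $\langle\mathbb{G};X{=}t\wedge\mathbb{B};\mathbb{V}\rangle\equiv\langle\mathbb{G}[X/t];X{=}t\wedge\mathbb{B};\mathbb{V}\rangle$; $\langle\mathbb{G};\mathbb{B};\mathbb{V}\rangle\equiv\langle\mathbb{G};\mathbb{B}';\mathbb{V}\rangle$ if $\mathcal{CT}\models\exists\bar s.\mathbb{B}\leftrightarrow\exists\bar s'.\mathbb{B}'$ ($\bar s,\bar s'$ the strictly local variables); $\langle\mathbb{G};\mathbb{B};\{X\}\cup\mathbb{V}\rangle\equiv\langle\mathbb{G};\mathbb{B};\mathbb{V}\rangle$ if $X$ does not occur; all states with store $\mathrm{false}$ are equivalent. For a (renamed-apart) rule $H_k\backslash H_r\Leftrightarrow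 G\mid B_c,B_b$ (simplification rule $H_r\Leftrightarrow G\mid B_c,B_b$ when $H_k=\emptyset$): $[\langle H_k\uplus H_r\uplus\mathbb{G};G\wedge\mathbb{B};\mathbb{V}\rangle]\mapsto[\langle H_k\uplus B_c\uplus\mathbb{G};G\wedge B_b\wedge\mathbb{B};\mathbb{V}\rangle]$. Translation. $\llbracket f\rrbracket$ is the sorted list of pairs of a finite function. $\mathrm{chr}(\Delta)$ is the list (order irrelevant) of terms $\mathrm{chunk}(\mathrm{id}_\Delta(c),t,\llbracket\mathrm{val}\rrbracket)$ for $c=(t,\mathrm{val})\in\Delta$, slot values written by identifiers. $\mathrm{chr}(\langle\Delta;\gamma;\upsilon\rangle)=\langle\{\mathrm{delta}(\mathrm{chr}(\Delta))\}\uplus\{\mathrm{gamma}(b,\mathrm{id}_\Delta(c),d)\mid b\in\mathbb{B},\gamma(b)=(c,d)\};\upsilon;\emptyset\rangle$. The constraint theory $\mathcal{CT}$ interprets built-ins: $\mathrm{action}$: for every action $\alpha=a(b,t,P)$, state $\sigma$, $D=\mathrm{chr}(\Delta)$, $G=\llbracket\gamma\rrbracket$ and $(\Delta^*,\gamma^*,\upsilon^* )\in I(\alpha,\sigma)$ with $\gamma^*(b)=(c^*,d^* )$: $\mathrm{action}(\alpha,D,G,D_r,C_r,E_r)\wedge\upsilon\leftrightarrow D_r=\mathrm{chr}(\Delta^* )\wedge C_r=\mathrm{id}_{\Delta^*}(c^* )\wedge E_r=d^*\wedge\upsilon\wedge\upsilon^*$; $\mathrm{merge}([\mathrm{chr}(\Delta_1),\dots,\mathrm{chr}(\Delta_n)],D)\leftrightarrow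 D=\mathrm{chr}(\Delta_1\circ\dots\circ\Delta_n)$; $\mathrm{map}(\mathrm{chr}(\Delta),\mathrm{chr}(\Delta'),C,C')\leftrightarrow C'=\mathrm{id}_{\Delta\circ\Delta'}(\mathrm{map}_{\Delta,\Delta'}(\mathrm{id}^{-1}_\Delta(C)))$ if a term $\mathrm{chunk}(C,\_,\_)$ is in $\mathrm{chr}(\Delta)$, else with $\mathrm{id}^{-1}_{\Delta'}(C)$; $c\ \mathrm{in}\ l$ holds iff $c$ equals some member of $l$. For each buffer $b$, $\mathrm{cvar}(b),\mathrm{dvar}(b),\mathrm{resstore}(b),\mathrm{resid}(b),\mathrm{resdelay}(b),\mathrm{mergeid}(b)$ are distinct fresh variables and $\mathrm{cogstate}(\mathbb{B})$ is the sorted list of pairs $(b,V_b)$ with fresh $V_b$. A rule $L\Rightarrow R$ in set normal form is translated to the CHR simplification rule with head $\mathrm{delta}(D)\uplus\{\mathrm{gamma}(b,\mathrm{cvar}(b),\mathrm{dvar}(b))\mid b\in\mathbb{B}\}$, guard $\bigwedge_{\mathrm{test}(b,t,P)\in L}(\mathrm{chunk}(\mathrm{cvar}(b),t,P)\ \mathrm{in}\ D\wedge\mathrm{dvar}(b)=0)$ ($P$ written as a sorted list, ACT-R variables as CHR variables), body CHR constraints $\{\mathrm{delta}(D^* )\}\uplus\{\mathrm{gamma}(b,\mathrm{mergeid}(b),\mathrm{resdelay}(b))\mid a(b,t,P)\in R\}\uplus\{\mathrm{gamma}(b,\mathrm{cvar}(b),\mathrm{dvar}(b))\mid$ no action on $b$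 in $R\}$, and body built-ins $\bigwedge_{\alpha=a(b,t,P)\in R}\mathrm{action}(\alpha,D,\mathrm{cogstate}(\mathbb{B}),\mathrm{resstore}(b),\mathrm{resid}(b),\mathrm{resdelay}(b))\wedge\mathrm{merge}([\mathrm{resstore}(b):a(b,t,P)\in R],D')\wedge\mathrm{merge}([D,D'],D^* )\wedge\bigwedge_{a(b,t,P)\in R}\mathrm{map}(D,D',\mathrm{resid}(b),\mathrm{mergeid}(b))$. $\mathrm{chr}(M)$ consists of the translations of all rules of $M$ together with the rule $\mathit{no}\ @\ \mathrm{gamma}(B,C,D)\Leftrightarrow D>0\mid\mathrm{gamma}(B,C,0)$.
   Formalization: Proved with: CT has action axioms only for σ's υ and one chosen effect per (action, Δ, γ), and (2) means for some such choice; V_b is the pair (cvar(b), dvar(b)); and it is assumed that combining a rule's effects never identifies or renames the chunks created for its different buffers. *)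

(* Defs.v *)
From HB Require Import structures.
From Stdlib Require List.
From mathcomp Require Import all_boot all_order all_algebra.
From mathcomp Require Import finmap reals.

Set Implicit Arguments.
Unset Strict Implicit.
Unset Printing Implicit Defensive.

Import Order.TTheory GRing.Theory Num.Theory.

Local Open Scope fset_scope.
Local Open Scope fmap_scope.

(** * Finite functions and sorting *)

Section FiniteFunctions.
Context {d : Order.disp_t} {C : orderType d}.

Definition sorted_fset (B : {fset C}) : seq C := sort <=%O (enum_fset B).

(* The sorted list of pairs [[f]]. *)
Definition graph_of (T : Type) (f : {fmap C -> T}) : seq (C * T) :=
  pmap (fun k => omap (pair k) f.[? k]) (sorted_fset (domf f)).

Definition fmap_sub (T : Type) (f g : {fmap C -> T}) : Prop :=
  forall k c, f.[? k] = Some c -> g.[? k] = Some c.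

Definition compatible (T : Type) (f g : {fmap C -> T}) : Prop :=
  forall k c c', f.[? k] = Some c -> g.[? k] = Some c' -> c = c'.

End FiniteFunctions.

(** * Terms *)

Inductive akind := Modify | Request.

Definition bool_of_akind k := if k is Modify then true else false.
Definition akind_of_bool (x : bool) := if x then Modify else Request.
Lemma bool_of_akindK : cancel bool_of_akind akind_of_bool.
Proof. by case. Qed.
HB.instance Definition _ := Choice.copy akind (can_type bool_of_akindK).

(* First-order terms over the variables X, the constants C and the reals.
   A list term is built from Nil and Cons; ground terms are terms over void. *)
Inductive term (C R X : Type) : Type :=
| Var of X
| Cst of C
| Num of R
| Nil
| Cons of term C R X & term C R X
| Pair of term C R X & term C R X
| ChunkT of term C R X & term C R X & term C R X
| ActT of akind & term C R X & term C R X & term C R X.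

Arguments Var {C R X}.
Arguments Cst {C R X}.
Arguments Num {C R X}.
Arguments Nil {C R X}.
Arguments Cons {C R X}.
Arguments Pair {C R X}.
Arguments ChunkT {C R X}.
Arguments ActT {C R X}.

Section TermChoice.
Context (C R X : Type).

Fixpoint tree_of_term (t : term C R X) : GenTree.tree (X + C + R) :=
  match t with
  | Var x => GenTree.Leaf (inl (inl x))
  | Cst c => GenTree.Leaf (inl (inr c))
  | Num r => GenTree.Leaf (inr r)
  | Nil => GenTree.Node 0 [::]
  | Cons a b => GenTree.Node 1 [:: tree_of_term a; tree_of_term b]
  | Pair a b => GenTree.Node 2 [:: tree_of_term a; tree_of_term b]
  | ChunkT a b c =>
      GenTree.Node 3 [:: tree_of_term a; tree_of_term b; tree_of_term c]
  | ActT Modify a b c =>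
      GenTree.Node 4 [:: tree_of_term a; tree_of_term b; tree_of_term c]
  | ActT Request a b c =>
      GenTree.Node 5 [:: tree_of_term a; tree_of_term b; tree_of_term c]
  end.

Fixpoint term_of_tree (t : GenTree.tree (X + C + R)) : term C R X :=
  match t with
  | GenTree.Leaf (inl (inl x)) => Var x
  | GenTree.Leaf (inl (inr c)) => Cst c
  | GenTree.Leaf (inr r) => Num r
  | GenTree.Node 1 [:: a; b] => Cons (term_of_tree a) (term_of_tree b)
  | GenTree.Node 2 [:: a; b] => Pair (term_of_tree a) (term_of_tree b)
  | GenTree.Node 3 [:: a; b; c] =>
      ChunkT (term_of_tree a) (term_of_tree b) (term_of_tree c)
  | GenTree.Node 4 [:: a; b; c] =>
      ActT Modify (term_of_tree a) (term_of_tree b) (term_of_tree c)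
  | GenTree.Node 5 [:: a; b; c] =>
      ActT Request (term_of_tree a) (term_of_tree b) (term_of_tree c)
  | _ => Nil
  end.

Lemma tree_of_termK : cancel tree_of_term term_of_tree.
Proof.
elim=> //= [a -> b ->|a -> b ->|a -> b -> c ->|[] a ea b eb c ec] //=.
- by rewrite ea eb ec.
- by rewrite ea eb ec.
Qed.

End TermChoice.

HB.instance Definition _ (C R X : choiceType) :=
  Choice.copy (term C R X) (can_type (@tree_of_termK C R X)).

Section TermOperations.
Context {C R : Type}.

Fixpoint tsubst (X Y : Type) (f : X -> term C R Y) (t : term C R X) :
    term C R Y :=
  match t with
  | Var x => f x
  | Cst c => Cst c
  | Num r => Num r
  | Nil => Nil
  | Cons a b => Cons (tsubst f a) (tsubst f b)
  | Pair a b => Pair (tsubst f a) (tsubst f b)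
  | ChunkT a b c => ChunkT (tsubst f a) (tsubst f b) (tsubst f c)
  | ActT k a b c => ActT k (tsubst f a) (tsubst f b) (tsubst f c)
  end.

Fixpoint tvars (X : Type) (t : term C R X) : seq X :=
  match t with
  | Var x => [:: x]
  | Cst _ | Num _ | Nil => [::]
  | Cons a b | Pair a b => tvars a ++ tvars b
  | ChunkT a b c | ActT _ a b c => tvars a ++ tvars b ++ tvars c
  end.

Definition ground_term := term C R void.

Definition of_ground (X : Type) : ground_term -> term C R X :=
  tsubst (fun v : void => match v with end).

Definition list_term (X : Type) (l : seq (term C R X)) : term C R X :=
  foldr Cons Nil l.

(* Equality with some member of a list term. *)
Fixpoint tmem (X : Type) (c l : term C R X) : Prop :=
  if l is Cons a l' then c = a \/ tmem c l' else False.

End TermOperations.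

Arguments ground_term : clear implicits.

(** * ACT-R *)

Section Actr.
Context {d : Order.disp_t} {C : orderType d} {V Q : choiceType} {R : realType}.

(* Conjunctions of ground atoms are finite sets of atoms: they are taken up to
   associativity, commutativity and idempotence.  Q is the set of predicate
   symbols available for additional information. *)
Definition atom : choiceType := (Q * seq (ground_term C R))%type.
Definition information := {fset atom}.

(* An identifier function being injective, a chunk is denoted throughout by its
   identifier: a (partial) chunk store is the finite map sending identifiers to
   chunks, and slots contain identifiers.  Several identifiers may carry the
   same pair (t, val), whence a multiset, and references may be cyclic. *)
Definition chunk := (C * {fmap C -> C})%type.
Definition store := {fmap C -> chunk}.
Definition cogstate := {fmap C -> C * R}.

Record signature := Signature {
  buffers : {fset C};
  is_type : pred C;
  slots : C -> {fset C};
  chunk_type : C;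
  (* the identifier of the chunk nil, the same in every chunk store *)
  nil_id : C;
  chunk_typeP : is_type chunk_type;
  slots_chunk_type : slots chunk_type = fset0 }.

Section Stores.
Variable S : signature.

Definition chunks_over (ids : {fset C}) (X : store) : Prop :=
  forall i t val, X.[? i] = Some (t, val) ->
    [/\ is_type S t, domf val = slots S t &
        forall s v, val.[? s] = Some v -> v \in ids].

Definition chunk_store (Delta : store) : Prop :=
  chunks_over (domf Delta) Delta /\
  Delta.[? nil_id S] = Some (chunk_type S, [fmap]).

(* X is a partial chunk store referring to Delta. *)
Definition partial_store (Delta X : store) : Prop :=
  chunks_over (domf Delta `|` domf X) X /\ [disjoint domf Delta & domf X].

Definition any_store (X : store) : Prop :=
  chunk_store X \/
  exists Delta, chunk_store Delta /\ partial_store Delta X.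

(* id^{-1}, as a map from constants to identifiers. *)
Definition chunk_at (Delta : store) (x : C) : C :=
  if x \in domf Delta then x else nil_id S.

(* The equations are only required where the merges they mention are
   admissible, i.e. chunks with equal identifiers are equal. *)
Record merging := Merging {
  mrg : store -> store -> store;
  (* the two summands are the chunks of the first and the second argument *)
  mrg_map : store -> store -> C + C -> C;
  mrg_store : forall Delta X, chunk_store Delta -> partial_store Delta X ->
    chunk_store (mrg Delta X);
  mrg_partial : forall Delta X Y, chunk_store Delta ->
    partial_store Delta X -> partial_store Delta Y -> compatible X Y ->
    partial_store Delta (mrg X Y);
  mrgA : forall X Y Z, any_store X -> any_store Y -> any_store Z ->
    compatible X Y -> compatible (mrg X Y) Z ->
    compatible Y Z -> compatible X (mrg Y Z) ->
    mrg X (mrg Y Z) = mrg (mrg X Y) Z;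
  mrg0s : forall X, any_store X -> mrg [fmap] X = X;
  mrgs0 : forall X, any_store X -> mrg X [fmap] = X;
  mrg_absorb : forall X Delta1 Delta2, any_store Delta1 -> any_store Delta2 ->
    compatible Delta1 Delta2 -> fmap_sub X Delta1 -> fmap_sub X Delta2 ->
    exists Y Z, [/\ mrg Delta1 Delta2 = mrg (mrg X Y) Z,
                    Delta1 = mrg X Y & Delta2 = mrg X Z];
  mrg_sub : forall X Y, any_store X -> any_store Y -> compatible X Y ->
    fmap_sub X (mrg X Y);
  mrg_map_left : forall X Y i, any_store X -> any_store Y -> compatible X Y ->
    i \in domf X -> mrg_map X Y (inl i) = i;
  mrg_map_right : forall X Y i, any_store X -> any_store Y ->
    compatible X Y -> i \in domf Y -> mrg_map X Y (inr i) \in domf (mrg X Y) }.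

Definition merge_all (m : merging) (Xs : seq store) : store :=
  if Xs is X :: Xs' then foldl (mrg m) X Xs' else [fmap].

End Stores.

Record architecture := Architecture {
  sig :> signature;
  merge_op : merging sig;
  (* request b t P u is a set of triples (chunk, delay, information), where
     the chunk comes with an
     identifier by which its own slots may refer to it *)
  request : C -> C -> {fset C * C} -> information ->
            (C * chunk) * R * information -> Prop;
  (* fresh b Delta names the chunk created in Delta by the action on b;
     injectivity keeps the results of different actions apart *)
  fresh : C -> store -> C;
  fresh_notin : forall b Delta, fresh b Delta \notin domf Delta;
  fresh_inj : forall Delta, {in buffers sig &, injective (fresh ^~ Delta)} }.

Record state := State { delta : store; gamma : cogstate; info : information }.

Definition abstract_state (S : signature) (sigma : state) : Prop :=
  [/\ chunk_store S (delta sigma), domf (gamma sigma) = buffers S &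
      forall b c r, (gamma sigma).[? b] = Some (c, r) ->
        c \in domf (delta sigma) /\ (0 <= r)%R].

(* (b, t, P) with slot-value pairs P whose values are taken in T. *)
Definition pattern (T : choiceType) : choiceType :=
  (C * C * {fset C * T})%type.
Definition test : choiceType := pattern (C + V)%type.
Definition action (T : choiceType) : choiceType := (akind * pattern T)%type.
Definition rule : choiceType :=
  ({fset test} * {fset action (C + V)%type})%type.

Definition pat_buffer (T : choiceType) (p : pattern T) : C := p.1.1.

Definition in_vars (x : V) (P : {fset C * (C + V)}) : Prop :=
  exists s, (s, inr x) \in P.

Definition actr_rule (S : signature) (r : rule) : Prop :=
  [/\ forall b t P, (b, t, P) \in r.1 -> b \in buffers S /\ is_type S t,
      forall k b t P, (k, (b, t, P)) \in r.2 -> b \in buffers S /\ is_type S t,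
      {in r.2 &, forall a a', pat_buffer a.2 = pat_buffer a'.2 -> a = a'} &
      forall x a, a \in r.2 -> in_vars x a.2.2 ->
        exists2 q, q \in r.1 & in_vars x q.2].

Definition set_normal_form (S : signature) (r : rule) : Prop :=
  forall b t P s, (b, t, P) \in r.1 -> s \in slots S t ->
    exists! v, (s, v) \in P.

Definition substitution := {fmap V -> C}.

Definition subst_value (theta : substitution) (v : C + V) : option C :=
  match v with inl c => Some c | inr x => theta.[? x] end.

Definition matches (theta : substitution) (r : rule) (sigma : state) : Prop :=
  forall b t P, (b, t, P) \in r.1 ->
    exists c val,
      [/\ (gamma sigma).[? b] = Some (c, 0%R),
          (delta sigma).[? c] = Some (t, val) &
          forall s v, (s, v) \in P ->
            exists2 x, val.[? s] = Some x & subst_value theta v = Some x].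

(* theta = Bindings(r, sigma); in particular r matches sigma. *)
Definition bindings (r : rule) (sigma : state) (theta : substitution) : Prop :=
  matches theta r sigma /\
  forall theta', matches theta' r sigma ->
    forall x c, theta.[? x] = Some c -> theta'.[? x] = Some c.

(* A pair with an unbound variable would be dropped; there is none when theta
   comes from bindings, since the variables of actions occur in tests. *)
Definition subst_action (theta : substitution) (a : action (C + V)%type) :
    action C :=
  (a.1, (a.2.1, [fset q in pmap
    (fun p => omap (pair p.1) (subst_value theta p.2)) (enum_fset a.2.2)])).

Record effect := Effect {
  e_delta : store; e_gamma : cogstate; e_info : information }.

(* The chunk val, known to itself as x, is renamed to i. *)
Definition rename_self (x i : C) (val : {fmap C -> C}) : {fmap C -> C} :=
  [fmap s : domf val => if val s == x then i else val s].

(* The set I(alpha, sigma).  A request result must fit into the chunk store: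
   its slots refer to the chunk itself or to chunks of delta sigma. *)
Inductive interp_action (A : architecture) (sigma : state) :
    action C -> effect -> Prop :=
| InterpModify b t P c r val0 val :
    (gamma sigma).[? b] = Some (c, r) ->
    (delta sigma).[? c] = Some (t, val0) ->
    domf val = slots A t ->
    (forall s v, s \in slots A t -> (s, v) \in P ->
       val.[? s] = Some (chunk_at A (delta sigma) v)) ->
    (forall s, s \in slots A t -> (forall v, (s, v) \notin P) ->
       val.[? s] = val0.[? s]) ->
    interp_action A sigma (Modify, (b, t, P))
      (Effect [fmap].[fresh A b (delta sigma) <- (t, val)]
              [fmap].[b <- (fresh A b (delta sigma), 0%R)]
              fset0)
| InterpRequest b t P x t' val r u X :
    request A b t P (info sigma) (x, (t', val), r, u) ->
    X = [fmap].[fresh A b (delta sigma) <-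
                  (t', rename_self x (fresh A b (delta sigma)) val)] ->
    partial_store A (delta sigma) X ->
    interp_action A sigma (Request, (b, t, P))
      (Effect X
              [fmap].[b <- (fresh A b (delta sigma),
                            if (0 < r)%R then 1%R else 0%R)]
              u).

Definition combine (A : architecture) (e f : effect) : effect :=
  let m c := mrg_map (merge_op A) (e_delta e) (e_delta f) c in
  Effect (mrg (merge_op A) (e_delta e) (e_delta f))
    [fmap b : domf (e_gamma e) `|` domf (e_gamma f) =>
       match (e_gamma e).[? val b], (e_gamma f).[? val b] with
       | Some (c, r), _ => (m (inl c), r)
       | None, Some (c, r) => (m (inr c), r)
       | None, None => (nil_id A, 0%R)
       end]
    (e_info e `|` e_info f).

Definition combine_all (A : architecture) (es : seq effect) : effect :=
  if es is e :: es' then foldl (combine A) e es'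
  else Effect [fmap] [fmap] fset0.

(* The actions of a rule in the order of their buffers: merging not being
   commutative, the same order is used on both sides of the translation. *)
Definition actions_of (r : rule) : seq (action (C + V)%type) :=
  sort (fun a a' => pat_buffer a.2 <= pat_buffer a'.2)%O (enum_fset r.2).

(* I(r theta, sigma) *)
Definition interp_rule (A : architecture) (r : rule) (theta : substitution)
    (sigma : state) (e : effect) : Prop :=
  exists2 es, List.Forall2 (interp_action A sigma)
                [seq subst_action theta a | a <- actions_of r] es &
              e = combine_all A es.

Definition update (A : architecture) (sigma : state) (e : effect) : state :=
  State (mrg (merge_op A) (delta sigma) (e_delta e))
    [fmap b : domf (gamma sigma) =>
       if (e_gamma e).[? val b] is Some (c, r)
       then (mrg_map (merge_op A) (delta sigma) (e_delta e) (inr c), r)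
       else gamma sigma b]
    (info sigma `|` e_info e).

Definition apply_step (A : architecture) (r : rule) (sigma sigma' : state) :
    Prop :=
  exists theta e, [/\ bindings r sigma theta, interp_rule A r theta sigma e &
                      sigma' = update A sigma e].

Definition no_rule_step (sigma sigma' : state) : Prop :=
  exists b c r, [/\ (gamma sigma).[? b] = Some (c, r), (0 < r)%R &
    sigma' = State (delta sigma) (gamma sigma).[b <- (c, 0%R)] (info sigma)].

Definition actr_step (A : architecture) (M : {fset rule})
    (sigma sigma' : state) : Prop :=
  (exists2 r, r \in M & apply_step A r sigma sigma') \/
  no_rule_step sigma sigma'.

(* Every action creates its chunk under the identifier fresh A b (delta sigma).
   When the results of the actions of a rule are combined, the chunk of each
   buffer is still there under that identifier, i.e. it has not been identified
   with a chunk created for another buffer.  This always holds for rules with at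
   most one action. *)
Definition results_kept (A : architecture) (M : {fset rule}) (sigma : state) :
    Prop :=
  forall r theta e, r \in M -> bindings r sigma theta ->
    interp_rule A r theta sigma e ->
    forall b c x, (e_gamma e).[? b] = Some (c, x) ->
      c = fresh A b (delta sigma) /\ c \in domf (e_delta e).

End Actr.

Arguments atom {d} C Q R.
Arguments information {d} C Q R.
Arguments signature {d} C.
Arguments architecture {d} C Q R.
Arguments state {d} C Q R.
Arguments effect {d} C Q R.
Arguments rule {d} C V.
Arguments store {d} C.
Arguments cogstate {d} C R.
Arguments action {d} C T.

(** * CHR *)

Section Chr.
Context {C Q : choiceType} {R : realType} {X : choiceType}.

Inductive constraint (X : Type) : Type :=
| Delta of term C R X
| Gamma of term C R X & term C R X & term C R X.

Inductive builtin (X : Type) : Type :=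
| BFalse
| BEq of term C R X & term C R X
| BGt of term C R X & term C R X
| BIn of term C R X & term C R X
| BAction of term C R X & term C R X & term C R X &
             term C R X & term C R X & term C R X
| BMerge of term C R X & term C R X
| BMap of term C R X & term C R X & term C R X & term C R X
| BInfo of Q & seq (term C R X).

Definition sum_of_constraint Y (c : constraint Y) :
    term C R Y + term C R Y * term C R Y * term C R Y :=
  match c with Delta a => inl a | Gamma a b c => inr (a, b, c) end.
Definition constraint_of_sum Y
    (c : term C R Y + term C R Y * term C R Y * term C R Y) : constraint Y :=
  match c with inl a => Delta a | inr (a, b, c) => Gamma a b c end.
Lemma sum_of_constraintK Y :
  cancel (@sum_of_constraint Y) (@constraint_of_sum Y).
Proof. by case. Qed.

HB.instance Definition _ :=
  Choice.copy (constraint X) (can_type (@sum_of_constraintK X)).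

Definition csubst Y (f : X -> term C R Y) (c : constraint X) : constraint Y :=
  match c with
  | Delta a => Delta (tsubst f a)
  | Gamma a b c => Gamma (tsubst f a) (tsubst f b) (tsubst f c)
  end.

Definition cvars (c : constraint X) : seq X :=
  match c with
  | Delta a => tvars a
  | Gamma a b c => tvars a ++ tvars b ++ tvars c
  end.

Definition bsubst Y (f : X -> term C R Y) (c : builtin X) : builtin Y :=
  let g := tsubst f in
  match c with
  | BFalse => BFalse Y
  | BEq a b => BEq (g a) (g b)
  | BGt a b => BGt (g a) (g b)
  | BIn a b => BIn (g a) (g b)
  | BAction a b c d e h => BAction (g a) (g b) (g c) (g d) (g e) (g h)
  | BMerge a b => BMerge (g a) (g b)
  | BMap a b c d => BMap (g a) (g b) (g c) (g d)
  | BInfo q l => BInfo q (map g l)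
  end.

Definition bvars (c : builtin X) : seq X :=
  match c with
  | BFalse => [::]
  | BEq a b | BGt a b | BIn a b | BMerge a b => tvars a ++ tvars b
  | BAction a b c d e h =>
      tvars a ++ tvars b ++ tvars c ++ tvars d ++ tvars e ++ tvars h
  | BMap a b c d => tvars a ++ tvars b ++ tvars c ++ tvars d
  | BInfo q l => flatten (map (@tvars C R X) l)
  end.

Definition csvars (G : seq (constraint X)) : seq X := flatten (map cvars G).
Definition bsvars (B : seq (builtin X)) : seq X := flatten (map bvars B).

(* Interpretations over the Herbrand universe (with the reals as constants);
   =, >, in and false have a fixed meaning. *)
Let gt := ground_term C R.
Record interpretation := Interpretation {
  i_action : gt -> gt -> gt -> gt -> gt -> gt -> Prop;
  i_merge : gt -> gt -> Prop;
  i_map : gt -> gt -> gt -> gt -> Prop;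
  i_info : Q -> seq gt -> Prop }.

Definition ground_holds (I : interpretation) (c : builtin void) : Prop :=
  match c with
  | BFalse => False
  | BEq a b => a = b
  | BGt (Num a) (Num b) => (b < a)%R
  | BGt _ _ => False
  | BIn a l => tmem a l
  | BAction a b c d e h => i_action I a b c d e h
  | BMerge a b => i_merge I a b
  | BMap a b c d => i_map I a b c d
  | BInfo q l => i_info I q l
  end.

Fixpoint holds (I : interpretation) (eta : X -> gt) (B : seq (builtin X)) :
    Prop :=
  if B is c :: B' then ground_holds I (bsubst eta c) /\ holds I eta B'
  else True.

(* The goal is a multiset, represented by a list up to permutation; the
   built-in store is the conjunction of a list, true being the empty one. *)
Record chr_state := ChrState {
  goal : seq (constraint X); bstore : seq (builtin X); globals : {fset X} }.

Definition strictly_local (S : chr_state) (x : X) : bool :=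
  [&& x \in bsvars (bstore S), x \notin csvars (goal S) &
      x \notin globals S].

(* I, eta |= exists s. B, where s are the strictly local variables of S. *)
Definition ex_local (I : interpretation) (eta : X -> gt) (S : chr_state) :
    Prop :=
  exists2 eta', (forall x, ~~ strictly_local S x -> eta' x = eta x) &
                holds I eta' (bstore S).

(* A constraint theory is given by its models. *)
Definition theory := interpretation -> Prop.

Inductive equiv (CT : theory) : chr_state -> chr_state -> Prop :=
| EqvRefl S : equiv CT S S
| EqvSym S T : equiv CT S T -> equiv CT T S
| EqvTrans S T U : equiv CT S T -> equiv CT T U -> equiv CT S U
| EqvMultiset G G' B W : perm_eq G G' ->
    equiv CT (ChrState G B W) (ChrState G' B W)
| EqvSubst G x t B W :
    equiv CT (ChrState G (BEq (Var x) t :: B) W)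
      (ChrState
         (map (csubst (fun y => if y == x then t else Var y)) G)
         (BEq (Var x) t :: B) W)
| EqvTheory G B B' W :
    (forall I eta, CT I ->
       ex_local I eta (ChrState G B W) <-> ex_local I eta (ChrState G B' W)) ->
    equiv CT (ChrState G B W) (ChrState G B' W)
| EqvGlobal G B x W : x \notin csvars G -> x \notin bsvars B ->
    equiv CT (ChrState G B (x |` W)) (ChrState G B W)
| EqvFail G G' W W' :
    equiv CT (ChrState G [:: BFalse X] W) (ChrState G' [:: BFalse X] W').

Record chr_rule := ChrRule {
  kept : seq (constraint X);
  removed : seq (constraint X);
  guard : seq (builtin X);
  body_chr : seq (constraint X);
  body_builtin : seq (builtin X) }.

Definition rule_vars (r : chr_rule) : seq X :=
  csvars (kept r) ++ csvars (removed r) ++ bsvars (guard r) ++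
  csvars (body_chr r) ++ bsvars (body_builtin r).

Definition rename_rule (rho : X -> X) (r : chr_rule) : chr_rule :=
  let f x := Var (rho x) in
  ChrRule (map (csubst f) (kept r)) (map (csubst f) (removed r))
    (map (bsubst f) (guard r)) (map (csubst f) (body_chr r))
    (map (bsubst f) (body_builtin r)).

Definition variant (r r' : chr_rule) : Prop :=
  exists2 rho : X -> X, {in rule_vars r &, injective rho} &
                        r' = rename_rule rho r.

(* The head variables of the variant are tied to the state by B; its other
   variables are new. *)
Definition renamed_apart (r : chr_rule) (G : seq (constraint X))
    (B : seq (builtin X)) (W : {fset X}) : Prop :=
  forall x, x \in rule_vars r -> x \notin csvars (kept r ++ removed r) ->
    [/\ x \notin csvars G, x \notin bsvars B & x \notin W].

Definition program := chr_rule -> Prop.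

Definition rewrites (P : program) (S S' : chr_state) : Prop :=
  exists r0 r G B W,
    [/\ P r0, variant r0 r, renamed_apart r G B W,
        S = ChrState (kept r ++ removed r ++ G) (guard r ++ B) W &
        S' = ChrState (kept r ++ body_chr r ++ G)
               (guard r ++ body_builtin r ++ B) W].

(* [S] |-> [S'] *)
Definition chr_step (CT : theory) (P : program) (S S' : chr_state) : Prop :=
  exists T T', [/\ equiv CT S T, rewrites P T T' & equiv CT T' S'].

End Chr.

Arguments chr_state : clear implicits.
Arguments chr_rule : clear implicits.
Arguments builtin : clear implicits.
Arguments constraint : clear implicits.
Arguments interpretation : clear implicits.

(** * Translation *)

Section Translation.
Context {d : Order.disp_t} {C : orderType d} {V Q : choiceType} {R : realType}.

(* CHR variables: the ACT-R variables, a family of variables for each buffer,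
   and countably many others. *)
Definition chr_var : choiceType := (V + nat * C + nat)%type.
Definition actr_var (x : V) : chr_var := inl (inl x).
Definition cvar (b : C) : chr_var := inl (inr (0, b)).
Definition dvar (b : C) : chr_var := inl (inr (1, b)).
Definition resstore (b : C) : chr_var := inl (inr (2, b)).
Definition resid (b : C) : chr_var := inl (inr (3, b)).
Definition resdelay (b : C) : chr_var := inl (inr (4, b)).
Definition mergeid (b : C) : chr_var := inl (inr (5, b)).
Definition var_D : chr_var := inr 0.
Definition var_D' : chr_var := inr 1.
Definition var_Dstar : chr_var := inr 2.

Section Encoding.
Context {X : Type}.
Local Notation tm := (term C R X).

Definition pairs_term (l : seq (C * tm)) : tm :=
  list_term [seq Pair (Cst p.1) p.2 | p <- l].

(* The order of the chunk terms being irrelevant, they are sorted by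
   identifier. *)
Definition chr_store (D : store C) : tm :=
  list_term [seq ChunkT (Cst p.1) (Cst p.2.1)
                   (pairs_term [seq (q.1, Cst q.2) | q <- graph_of p.2.2])
            | p <- graph_of D].

Definition chr_gamma (g : cogstate C R) : tm :=
  pairs_term [seq (p.1, Pair (Cst p.2.1) (Num p.2.2)) | p <- graph_of g].

Definition ground_action_term (k : akind) (b t : C) (l : seq (C * C)) : tm :=
  ActT k (Cst b) (Cst t) (pairs_term [seq (p.1, Cst p.2) | p <- l]).

Definition chr_info (u : information C Q R) : seq (builtin C Q R X) :=
  [seq BInfo a.1 [seq of_ground X t | t <- a.2] | a <- enum_fset u].

End Encoding.

Definition chr_of_state (sigma : state C Q R) : chr_state C Q R chr_var :=
  ChrState
    (Delta (chr_store (delta sigma)) ::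
     [seq Gamma (Cst p.1) (Cst p.2.1) (Num p.2.2)
     | p <- graph_of (gamma sigma)])
    (chr_info (info sigma)) fset0.

(** ** The constraint theory *)

Definition info_holds (I : interpretation C Q R) (u : information C Q R) :
    Prop :=
  forall a, a \in u -> i_info I a.1 a.2.

(* The equivalence by which the theory defines the built-in action has the
   actual arguments (alpha, D, G) on the left and one outcome in
   I(alpha, sigma) on the right, where sigma also contains the additional
   information, which is not an argument of action.  Equivalences for different
   outcomes, or for different additional information, of the same call
   contradict each other.  A theory is therefore relative to the additional
   information u of the state under consideration and to a choice of one outcome
   for each action, chunk store and cognitive state, whenever there is one. *)
Definition outcome_choice :=
  action C C -> store C -> cogstate C R -> effect C Q R.

Definition choice_of_outcomes (A : architecture C Q R) (u : information C Q R)
    (out : outcome_choice) : Prop :=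
  forall a D g, abstract_state A (State D g u) ->
    (exists e, interp_action A (State D g u) a e) ->
    interp_action A (State D g u) a (out a D g).

(* The slot-value pairs of an action may be listed in any way, since
   instantiating variables in a list sorted by slots may produce repetitions. *)
Record ct_model (A : architecture C Q R) (u : information C Q R)
    (out : outcome_choice) (I : interpretation C Q R) : Prop := CtModel {
  ct_action : forall k b t l D g e c r,
    abstract_state A (State D g u) ->
    interp_action A (State D g u) (k, (b, t, [fset p in l])) e ->
    e = out (k, (b, t, [fset p in l])) D g ->
    (e_gamma e).[? b] = Some (c, r) ->
    forall Dr Cr Er,
      (i_action I (ground_action_term k b t l) (chr_store D) (chr_gamma g)
         Dr Cr Er /\ info_holds I u) <->
      [/\ Dr = chr_store (e_delta e), Cr = Cst c, Er = Num r,
          info_holds I u & info_holds I (e_info e)];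
  ct_merge : forall (Ds : seq (store C)) D,
    i_merge I (list_term [seq chr_store D0 | D0 <- Ds]) D <->
    D = chr_store (merge_all (merge_op A) Ds);
  ct_map : forall D D' c C',
    i_map I (chr_store D) (chr_store D') (Cst c) C' <->
    C' = Cst (mrg_map (merge_op A) D D'
                (if c \in domf D then inl c
                 else if c \in domf D' then inr c
                 else inl (nil_id A))) }.

(** ** Rules *)

Local Notation ctm := (term C R chr_var).

Definition value_term (v : C + V) : ctm :=
  match v with inl c => Cst c | inr x => Var (actr_var x) end.

Definition pattern_term (P : {fset C * (C + V)}) : ctm :=
  pairs_term [seq (p.1, value_term p.2)
             | p <- sort (fun p q => p.1 <= q.1)%O (enum_fset P)].

Definition gamma_var (b : C) : constraint C R chr_var :=
  Gamma (Cst b) (Var (cvar b)) (Var (dvar b)).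

(* The variable standing for gamma(b) in the cognitive state is the pair of
   cvar(b) and dvar(b). *)
Definition cogstate_term (B : {fset C}) : ctm :=
  pairs_term [seq (b, Pair (Var (cvar b)) (Var (dvar b)))
             | b <- sorted_fset B].

Definition test_guard (q : test) : seq (builtin C Q R chr_var) :=
  let: (b, t, P) := q in
  [:: BIn (ChunkT (Var (cvar b)) (Cst t) (pattern_term P)) (Var var_D);
      BEq (Var (dvar b)) (Num 0%R)].

Definition chr_of_rule (S : signature C) (r : rule C V) :
    chr_rule C Q R chr_var :=
  let acts := actions_of r in
  let abufs := [seq pat_buffer a.2 | a <- acts] in
  let bufs := sorted_fset (buffers S) in
  ChrRule [::]
    (Delta (Var var_D) :: map gamma_var bufs)
    (flatten (map test_guard (enum_fset r.1)))
    (Delta (Var var_Dstar) ::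
     [seq Gamma (Cst b) (Var (mergeid b)) (Var (resdelay b)) | b <- abufs] ++
     [seq gamma_var b | b <- bufs & b \notin abufs])
    ([seq let: (k, (b, t, P)) := a in
          BAction (ActT k (Cst b) (Cst t) (pattern_term P))
            (Var var_D) (cogstate_term (buffers S))
            (Var (resstore b)) (Var (resid b)) (Var (resdelay b))
     | a <- acts] ++
     [:: BMerge (list_term [seq Var (resstore b) | b <- abufs]) (Var var_D');
         BMerge (list_term [:: Var var_D; Var var_D']) (Var var_Dstar)] ++
     [seq BMap (Var var_D) (Var var_D') (Var (resid b)) (Var (mergeid b))
     | b <- abufs]).

Definition no_chr_rule : chr_rule C Q R chr_var :=
  let B : ctm := Var (inr 0) in
  let K : ctm := Var (inr 1) in
  let D : ctm := Var (inr 2) in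
  ChrRule [::] [:: Gamma B K D] [:: BGt D (Num 0%R)]
    [:: Gamma B K (Num 0%R)] [::].

Definition chr_of_model (S : signature C) (M : {fset rule C V}) :
    @program C Q R chr_var :=
  fun cr => (exists2 r, r \in M & cr = chr_of_rule S r) \/ cr = no_chr_rule.

End Translation.

(* Main.v *)
Require Import Defs.
From Stdlib Require List.
From mathcomp Require Import all_boot all_order all_algebra.
From mathcomp Require Import finmap boolp reals.

(* Soundness and completeness are both read off the instances of a CHR state:
   the ground goals obtained from the valuations that satisfy its built-in store
   in a fixed interpretation.  State equivalence preserves the instances in
   every model of the theory, and a state whose goal is ground has at most one.
   A step from chr(sigma) is therefore governed by a single valuation of the
   rule: the guard makes it a match, and the built-ins of the body force the
   values of all the remaining variables.  Conversely, a state in which every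
   model forces one and the same ground goal is equivalent to that ground state.

   The conditions "for all models" are exploited on the least model of the
   theory in which exactly a given finite set w of ground atoms holds.  There
   the built-in action only succeeds on genuine ACT-R effects, so that a step of
   the CHR program comes from a match of the rule; and letting w vary shows
   which additional information the target state contains. *)

Set Implicit Arguments.
Unset Strict Implicit.
Unset Printing Implicit Defensive.

Import Order.TTheory GRing.Theory Num.Theory.
(* Again, since MathComp has its own Num and equiv. *)
Import Defs.

Local Open Scope fset_scope.
Local Open Scope fmap_scope.

(** * CHR states and their instances *)

Lemma mem_In (T : eqType) (x : T) s : x \in s <-> List.In x s.
Proof.
elim: s => //= y s ih; rewrite inE; split=> [/predU1P[->|/ih]|[->|/ih->]]; auto.
  by rewrite eqxx.
by rewrite orbT.
Qed.

(** * Substitution and variables in terms *)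

Section Terms.
Context {C R : Type}.

Lemma eq_in_tsubst (X : eqType) Y (f g : X -> term C R Y) t :
  {in tvars t, f =1 g} -> tsubst f t = tsubst g t.
Proof.
elim: t => //= [x|a ha b hb|a ha b hb|a ha b hb c hc|k a ha b hb c hc] h.
all: rewrite ?h ?mem_head ?ha ?hb ?hc // => x xt; apply: h.
all: by rewrite ?mem_cat xt ?orbT.
Qed.

Lemma tsubst_tsubst X Y Z (f : X -> term C R Y) (g : Y -> term C R Z) t :
  tsubst g (tsubst f t) = tsubst (fun x => tsubst g (f x)) t.
Proof.
by elim: t => //= [a -> b ->|a -> b ->|a -> b -> c ->|k a -> b -> c ->].
Qed.

Lemma tsubst_var X t : tsubst (@Var C R X) t = t.
Proof.
by elim: t => //= [a -> b ->|a -> b ->|a -> b -> c ->|k a -> b -> c ->].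
Qed.

Lemma of_groundK X (f : X -> ground_term C R) t :
  tsubst f (of_ground X t) = t.
Proof.
rewrite /of_ground tsubst_tsubst -[RHS]tsubst_var.
by apply: (@eq_in_tsubst void) => -[].
Qed.

Lemma tsubst_of_ground X Y (f : X -> term C R Y) t :
  tsubst f (of_ground X t) = of_ground Y t.
Proof.
by rewrite /of_ground tsubst_tsubst; apply: (@eq_in_tsubst void) => -[].
Qed.

Lemma tvars_of_ground X (t : ground_term C R) :
  tvars (of_ground X t) = [::].
Proof.
by elim: t => //= [a -> b ->|a -> b ->|a -> b -> c ->|k a -> b -> c ->].
Qed.

Lemma tvars_tsubst (X Y : Type) (f : X -> term C R Y) t :
  tvars (tsubst f t) = flatten [seq tvars (f x) | x <- tvars t].
Proof.
elim: t => //= [x|a ha b hb|a ha b hb|a ha b hb c hc|k a ha b hb c hc].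
all: by rewrite ?cats0 // !map_cat !flatten_cat ?ha ?hb ?hc.
Qed.

Lemma list_term_inj X : injective (@list_term C R X).
Proof. by elim=> [|a l ih] [|b m] //= [-> /ih ->]. Qed.

Lemma tsubst_list_term X Y (f : X -> term C R Y) l :
  tsubst f (list_term l) = list_term (map (tsubst f) l).
Proof. by elim: l => //= a l ->. Qed.

Lemma tvars_list_term X (l : seq (term C R X)) :
  tvars (list_term l) = flatten (map (@tvars C R X) l).
Proof. by elim: l => //= a l ->. Qed.

Lemma tmem_list_term X (c : term C R X) l :
  tmem c (list_term l) <-> List.In c l.
Proof. by elim: l => //= a l ->; split=> -[]; auto. Qed.

End Terms.

(** * Substitution in constraints and built-ins *)

Section Substitutions.
Context {C Q : choiceType} {R : realType}.
Implicit Types X Y Z : choiceType.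

Lemma eq_in_csubst X Y (f g : X -> term C R Y) (c : constraint C R X) :
  {in cvars c, f =1 g} -> csubst f c = csubst g c.
Proof.
case: c => [a|a b c] /= h; rewrite !(eq_in_tsubst (g := g)) //.
all: by move=> x xt; apply: h; rewrite ?mem_cat xt ?orbT.
Qed.

Lemma csubst_csubst X Y Z (f : X -> term C R Y) (g : Y -> term C R Z)
    (c : constraint C R X) :
  csubst g (csubst f c) = csubst (fun x => tsubst g (f x)) c.
Proof. by case: c => [a|a b c] /=; rewrite !tsubst_tsubst. Qed.

Lemma csubst_var X (c : constraint C R X) : csubst Var c = c.
Proof. by case: c => [a|a b c] /=; rewrite !tsubst_var. Qed.

Lemma eq_in_bsubst X Y (f g : X -> term C R Y) (c : builtin C Q R X) :
  {in bvars c, f =1 g} -> bsubst f c = bsubst g c.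
Proof.
case: c => //= [a b|a b|a b|a b c e h i|a b|a b c e|q l] H.
1-6: by rewrite !(eq_in_tsubst (g := g)) // => x xt; apply: H;
  rewrite ?mem_cat xt ?orbT.
congr BInfo; elim: l H => //= t l ih H; rewrite (eq_in_tsubst (g := g)).
  by rewrite ih // => x xl; apply: H; rewrite mem_cat xl orbT.
by move=> x xt; apply: H; rewrite mem_cat xt.
Qed.

Lemma bsubst_bsubst X Y Z (f : X -> term C R Y) (g : Y -> term C R Z)
    (c : builtin C Q R X) :
  bsubst g (bsubst f c) = bsubst (fun x => tsubst g (f x)) c.
Proof.
case: c => //= *; rewrite ?tsubst_tsubst //; congr BInfo.
by rewrite -map_comp; apply: eq_map => t /=; rewrite tsubst_tsubst.
Qed.

Lemma bsubst_var X (c : builtin C Q R X) : bsubst Var c = c.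
Proof.
case: c => //= *; rewrite ?tsubst_var //; congr BInfo.
by rewrite (eq_map (@tsubst_var _ _ _)) map_id.
Qed.

Definition cground Y (c : constraint C R void) : constraint C R Y :=
  csubst (fun v : void => match v with end) c.

Lemma csubst_of_ground X Y (f : X -> ground_term C R) (c : constraint C R X) :
  csubst (fun x => of_ground Y (f x)) c = cground Y (csubst f c).
Proof. by rewrite /cground csubst_csubst. Qed.

Lemma csvars_cground X (G : seq (constraint C R void)) :
  csvars (map (cground X) G) = [::] :> seq X.
Proof.
elim: G => //= c G ih; rewrite /csvars /= -/(csvars _) ih cats0.
by case: c => [a|a b c] /=; rewrite !tvars_of_ground.
Qed.

Lemma csvars_cat X (G G' : seq (constraint C R X)) :
  csvars (G ++ G') = csvars G ++ csvars G'.
Proof. by rewrite /csvars map_cat flatten_cat. Qed.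

Lemma bsvars_cat X (B B' : seq (builtin C Q R X)) :
  bsvars (B ++ B') = bsvars B ++ bsvars B'.
Proof. by rewrite /bsvars map_cat flatten_cat. Qed.

Lemma mem_csvars X (G : seq (constraint C R X)) c x :
  c \in G -> x \in cvars c -> x \in csvars G.
Proof. by move=> cG xc; apply/flatten_mapP; exists c. Qed.

Lemma eq_in_map_csubst X Y (f g : X -> term C R Y)
    (G : seq (constraint C R X)) :
  {in csvars G, f =1 g} -> map (csubst f) G = map (csubst g) G.
Proof.
move=> h; apply/eq_in_map => c cG; apply: eq_in_csubst => x xc.
by apply: h; exact: mem_csvars xc.
Qed.

Context (I : interpretation C Q R).

Lemma holds_cat X (eta : X -> ground_term C R) B B' :
  holds I eta (B ++ B') <-> holds I eta B /\ holds I eta B'.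
Proof. by elim: B => [|c B ih] /=; [tauto|rewrite ih; tauto]. Qed.

Lemma eq_in_holds X (eta eta' : X -> ground_term C R) B :
  {in bsvars B, eta =1 eta'} -> holds I eta B -> holds I eta' B.
Proof.
elim: B => [|c B ih] //= h [hc hB]; split.
  by rewrite -(@eq_in_bsubst _ _ eta eta') // => x xc; apply: h;
    rewrite /bsvars /= mem_cat xc.
by apply: ih hB => x xB; apply: h; rewrite /bsvars /= mem_cat xB orbT.
Qed.

Lemma holds_map_bsubst X Y (f : X -> term C R Y) (eta : Y -> ground_term C R)
    B :
  holds I eta (map (bsubst f) B) <-> holds I (fun x => tsubst eta (f x)) B.
Proof. by elim: B => //= c B ->; rewrite bsubst_bsubst. Qed.

End Substitutions.

(** * State equivalence and its semantic invariants *)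

Section Equivalence.
Context {C Q X : choiceType} {R : realType}.
Implicit Types (S T : chr_state C Q R X) (I : interpretation C Q R).
Implicit Types (G : seq (constraint C R X)) (B : seq (builtin C Q R X)).
Local Notation val := (X -> ground_term C R).

(** Global variables are instantiated like local ones, so [EqvGlobal] changes nothing; comparing
    goals up to permutation treats them as multisets. *)
Definition instance I S (G : seq (constraint C R void)) : Prop :=
  exists2 eta : val, holds I eta (bstore S) &
                     perm_eq (map (csubst eta) (goal S)) G.

(** Induction on the derivation. [EqvSubst] is harmless because [eta] satisfies the equation;
    [EqvTheory] only re-values strictly local variables, which do not occur in the goal; a failed
    state has no instance. *)
Lemma equiv_instance (CT : theory (C := C) (Q := Q) (R := R)) I S T
    (G : seq (constraint C R void)) :
  CT I -> equiv CT S T -> instance I S G <-> instance I T G.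
Proof.
move=> CTI; elim=> {S T} //.
- by move=> S T _ ->.
- by move=> S T U _ -> _ ->.
- move=> G1 G2 B W G12; split=> -[eta hB p]; exists eta => //=;
    by apply: perm_trans p; rewrite perm_map // perm_sym.
- move=> G0 x t B W; have eqG (eta : val) : eta x = tsubst eta t ->
      map (csubst eta) (map (csubst (fun y => if y == x then t else Var y)) G0)
      = map (csubst eta) G0.
    move=> eqx; rewrite -map_comp; apply: eq_map => c /=.
    by rewrite csubst_csubst; apply: eq_in_csubst => y _; case: eqP => [->|].
  by split=> -[eta /= [eqx hB] p]; exists eta => //=; move: p; rewrite eqG.
- move=> G0 B B' W h; split=> -[eta /= hB p].
    have [|eta' ext hB'] := (h I eta CTI).1; first by exists eta.
    exists eta' => //=; apply: perm_trans p.
    rewrite (@eq_in_map_csubst _ _ _ _ eta' eta) // => x xG; apply: ext.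
    by rewrite /strictly_local /= xG andbF.
  have [|eta' ext hB'] := (h I eta CTI).2; first by exists eta.
  exists eta' => //=; apply: perm_trans p.
  rewrite (@eq_in_map_csubst _ _ _ _ eta' eta) // => x xG; apply: ext.
  by rewrite /strictly_local /= xG andbF.
- by move=> *; split=> -[eta /= []].
Qed.

(** * States equivalent to a ground state *)

Section Ground.
Variable CT : theory (C := C) (Q := Q) (R := R).
Variable eta0 : val.

(** The valuation [eta0] on [vs], written into a built-in store. *)
Definition eqns (vs : seq X) : seq (builtin C Q R X) :=
  [seq BEq (Var x) (of_ground X (eta0 x)) | x <- vs].

Lemma holds_eqns I (eta : val) vs :
  holds I eta (eqns vs) <-> {in vs, eta =1 eta0}.
Proof.
elim: vs => [|x vs ih] /=; first by split.
rewrite of_groundK ih; split=> [[ex h] y|h].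
  by rewrite inE => /predU1P[->|/h].
by split=> [|y yvs]; apply: h; rewrite inE ?eqxx // yvs orbT.
Qed.

Lemma bsvars_eqns vs : bsvars (eqns vs) = vs.
Proof.
by elim: vs => //= x vs ih; rewrite /bsvars /= tvars_of_ground -/(bsvars _) ih.
Qed.

(** Strict locality depends on the built-in store only through its set of variables, so a plain
    equivalence lifts under the existential quantifiers. *)
Lemma equiv_same_vars G B B' W :
  bsvars B =i bsvars B' ->
  (forall I eta, CT I -> holds I eta B <-> holds I eta B') ->
  equiv CT (ChrState G B W) (ChrState G B' W).
Proof.
move=> vB hB; apply: EqvTheory => I eta CTI.
have eql x : strictly_local (ChrState G B W) x =
             strictly_local (ChrState G B' W) x.
  by rewrite /strictly_local /= vB.
by split=> -[eta' ext h]; exists eta' => [x|/=];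
  [rewrite -eql; apply: ext|apply/hB|rewrite eql; apply: ext|apply/hB].
Qed.


Lemma equiv_eqns G B W (vs ws : seq X) : {subset vs <= ws} ->
  equiv CT (ChrState G (eqns ws ++ B) W)
    (ChrState (map (csubst (fun y => if y \in vs then of_ground X (eta0 y)
                                     else Var y)) G) (eqns ws ++ B) W).
Proof.
elim: vs => [|x vs ih] sub.
  by rewrite (eq_map (@csubst_var _ _ _)) map_id; apply: EqvRefl.
have xws : x \in ws by apply: sub; rewrite mem_head.
apply: EqvTrans (ih _) _ => [y yvs|]; first by apply: sub; rewrite inE yvs orbT.
set G1 := map _ G; set E := eqns ws ++ B.
have EE : BEq (Var x) (of_ground X (eta0 x)) :: E = eqns (x :: ws) ++ B by [].
have vE us : bsvars (eqns us ++ B) = us ++ bsvars B.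
  by rewrite bsvars_cat bsvars_eqns.
have hE us I eta : holds I eta (eqns us ++ B) <->
    {in us, eta =1 eta0} /\ holds I eta B.
  by rewrite holds_cat holds_eqns.
(* [EqvSubst] uses an equation at the head of the store. The equation for [x] is therefore
   duplicated in front and removed after the substitution; as [x] is among [ws], the copy adds no
   variable. *)
have drop G' : equiv CT (ChrState G' E W)
    (ChrState G' (BEq (Var x) (of_ground X (eta0 x)) :: E) W).
  apply: equiv_same_vars => [y|I eta CTI].
    rewrite EE (vE ws) (vE (x :: ws)) cat_cons inE mem_cat.
    by case: eqP => [->|_] //=; rewrite xws.
  rewrite EE (hE ws) (hE (x :: ws)).
  split=> -[h hB]; split=> // y; last first.
    by move=> yws; apply: h; rewrite inE yws orbT.
  by rewrite inE => /predU1P[->|]; apply: h.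
apply: EqvTrans (drop _) _; apply: EqvTrans (EqvSubst _ _ _ _ _ _) _.
rewrite /G1 -map_comp.
rewrite (@eq_map _ _ _ (csubst (fun y =>
  if y \in x :: vs then of_ground X (eta0 y) else Var y))).
  exact: EqvSym.
move=> c /=; rewrite csubst_csubst; apply: eq_in_csubst => y _.
rewrite inE; case: ifP => [|yvs] /=; first by rewrite orbT tsubst_of_ground.
by rewrite orbF; case: eqP => [->|].
Qed.

Lemma equiv_ground G B B0 :
  bsvars B0 = [::] ->
  (forall I eta, CT I -> holds I eta B ->
     {in csvars G, eta =1 eta0} /\ holds I eta B0) ->
  (forall I eta, CT I -> holds I eta B0 -> holds I eta0 B) ->
  equiv CT (ChrState G B fset0)
    (ChrState (map (cground X) (map (csubst eta0) G)) B0 fset0).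
Proof.
move=> gB0 hB hB0; set E := eqns (csvars G).
have B0eta I (eta eta' : val) : holds I eta B0 <-> holds I eta' B0.
  by split; apply: eq_in_holds => x; rewrite gB0.
have step1 : equiv CT (ChrState G B fset0) (ChrState G (E ++ B0) fset0).
  apply: EqvTheory => I eta CTI; split=> -[eta' ext h].
    exists eta => //=; have [eG hB0'] := hB _ _ CTI h.
    apply/holds_cat; split; last by apply/(B0eta _ _ eta').
    apply/holds_eqns => x xG; rewrite -ext ?eG //.
    by rewrite /strictly_local /= xG andbF.
  have hE : holds I eta (E ++ B0).
    apply: eq_in_holds h => x.
    rewrite /= bsvars_cat gB0 cats0 bsvars_eqns => xG.
    by rewrite -ext // /strictly_local /= xG andbF.
  have [/holds_eqns eG /hB0 -/(_ CTI) h0] := (holds_cat I eta E B0).1 hE.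
  (* Only strictly local variables may be re-valued. Every other variable of [B] occurs in [G],
     there being no globals, and there the equations already force the value of [eta0]. *)
  exists (fun x => if strictly_local (ChrState G B fset0) x then eta0 x
                   else eta x) => [x /negbTE-> //|/=].
apply: eq_in_holds h0 => x xB; rewrite /strictly_local /= xB ?andbT /=.
  by case: ifPn => // /negbNE /eG.
apply: EqvTrans step1 _.
apply: EqvTrans (@equiv_eqns _ _ _ (csvars G) _ _) _ => //.
rewrite (@eq_in_map_csubst _ _ _ _ _ (fun x => of_ground X (eta0 x)));
  last by move=> x ->.
rewrite (eq_map (csubst_of_ground _ _)) map_comp.
apply: EqvTheory => I eta CTI; split=> -[eta' ext h].
  have [_ h0] := (holds_cat I _ E B0).1 h.
  by exists eta => //; apply/B0eta; exact: h0.
(* The goal is ground by now, so all variables of the equations are strictly local and may take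
   their values from [eta0]. *)
exists (fun x => if x \in csvars G then eta0 x else eta x) => [x|/=].
  rewrite /strictly_local /= csvars_cground bsvars_cat gB0 cats0 bsvars_eqns.
  rewrite ?inE.
  by rewrite !andbT => /negbTE->.
apply/holds_cat; split; last by apply/B0eta; exact: h.
by apply/holds_eqns => x ->.
Qed.

End Ground.
End Equivalence.

(** * Encodings and the least model of the constraint theory *)

Section FiniteMaps.
Context {d : Order.disp_t} {C : orderType d}.

Lemma mem_sorted_fset (B : {fset C}) k : (k \in sorted_fset B) = (k \in B).
Proof. by rewrite /sorted_fset mem_sort. Qed.

Lemma uniq_sorted_fset (B : {fset C}) : uniq (sorted_fset B).
Proof. by rewrite /sorted_fset sort_uniq fset_uniq. Qed.

Lemma graph_of_total T (f : {fmap C -> T}) (g : C -> T) :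
  (forall k, k \in domf f -> f.[? k] = Some (g k)) ->
  graph_of f = [seq (k, g k) | k <- sorted_fset (domf f)].
Proof.
move=> fg; rewrite /graph_of.
have: {subset sorted_fset (domf f) <= domf f}.
  by move=> k; rewrite mem_sorted_fset.
elim: (sorted_fset _) => //= k s ih sub; rewrite fg ?sub ?mem_head //= ih //.
by move=> k' k's; apply: sub; rewrite inE k's orbT.
Qed.

Lemma fst_graph_of T (f : {fmap C -> T}) :
  map fst (graph_of f) = sorted_fset (domf f).
Proof.
rewrite /graph_of.
have: {subset sorted_fset (domf f) <= domf f}.
  by move=> k; rewrite mem_sorted_fset.
elim: (sorted_fset _) => //= k s ih sub.
rewrite in_fnd ?sub ?mem_head //= => kf.
by rewrite ih // => k' k's; apply: sub; rewrite inE k's orbT.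
Qed.

Lemma mem_graph_of (T : eqType) (f : {fmap C -> T}) k v :
  ((k, v) \in graph_of f) = (f.[? k] == Some v).
Proof.
rewrite /graph_of mem_pmap; apply/mapP/eqP => [[k' _]|fk].
  by case fk: f.[? k'] => [w|] //= [-> ->].
exists k; last by rewrite fk.
by rewrite mem_sorted_fset; case: fndP fk.
Qed.

Lemma graph_of_inj (T : eqType) : injective (@graph_of _ C T).
Proof.
move=> f g fg; apply/fmapP => k.
case fk: f.[? k] => [v|].
  by move/eqP: fk; rewrite -mem_graph_of fg mem_graph_of => /eqP.
case gk: g.[? k] => [v|//].
by move/eqP: gk; rewrite -mem_graph_of -fg mem_graph_of fk.
Qed.

End FiniteMaps.

(** * Injectivity of the encodings, and ground goals *)

Section Encodings.
Context {d : Order.disp_t} {C : orderType d} {V Q : choiceType} {R : realType}.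
Local Notation chr_var := (@chr_var d C V).

Lemma pairs_term_inj X : injective (@pairs_term d C R X).
Proof.
by move=> l m /list_term_inj; apply: inj_map => -[k v] [k' v'] [/= -> ->].
Qed.

Lemma tsubst_pairs_term X Y (f : X -> term C R Y) (l : seq (C * term C R X)) :
  tsubst f (pairs_term l) = pairs_term [seq (p.1, tsubst f p.2) | p <- l].
Proof. by rewrite /pairs_term tsubst_list_term -!map_comp. Qed.

Lemma tvars_pairs_term X (l : seq (C * term C R X)) :
  tvars (pairs_term l) = flatten [seq tvars p.2 | p <- l].
Proof. by rewrite /pairs_term tvars_list_term -map_comp. Qed.

Lemma slots_term_inj X :
  injective (fun l : seq (C * C) =>
    pairs_term [seq (q.1, Cst q.2 : term C R X) | q <- l]).
Proof.
by move=> l m /pairs_term_inj; apply: inj_map => -[s v] [s' v'] [/= -> ->].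
Qed.

(** Since chunks and slots are listed in sorted order, the term determines the store. This lets
    built-ins that are specified on encodings determine their store arguments. *)
Lemma chr_store_inj X : injective (@chr_store d C R X).
Proof.
move=> D D' /list_term_inj e; apply: graph_of_inj; apply: inj_map e.
by move=> [i [t v]] [i' [t' v']] [/= -> -> /slots_term_inj/graph_of_inj->].
Qed.

Lemma chr_gamma_inj X : injective (@chr_gamma d C R X).
Proof.
move=> g g' /pairs_term_inj e; apply: graph_of_inj; apply: inj_map e.
by move=> [b [c r]] [b' [c' r']] [/= -> -> ->].
Qed.

Lemma tsubst_chr_store X Y (f : X -> term C R Y) D :
  tsubst f (chr_store D) = chr_store D.
Proof.
rewrite /chr_store tsubst_list_term -map_comp; congr list_term.
by apply: eq_map => p /=; rewrite tsubst_pairs_term -map_comp.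
Qed.

Lemma ground_action_term_inj X k b t l k' b' t' l' :
  @ground_action_term d C R X k b t l = ground_action_term k' b' t' l' ->
  [/\ k = k', b = b', t = t' & l = l'].
Proof. by case=> -> -> -> /slots_term_inj->. Qed.


Definition ground_goal (sigma : state C Q R) : seq (constraint C R void) :=
  Delta (chr_store (delta sigma)) ::
  [seq Gamma (Cst p.1) (Cst p.2.1) (Num p.2.2) | p <- graph_of (gamma sigma)].

Lemma cground_ground_goal (sigma : state C Q R) :
  map (cground chr_var) (ground_goal sigma) = goal (chr_of_state sigma).
Proof.
rewrite /= /cground /= tsubst_chr_store -map_comp; congr cons.
Qed.

Lemma csubst_goal (eta : chr_var -> ground_term C R) (sigma : state C Q R) :
  map (csubst eta) (goal (chr_of_state sigma)) = ground_goal sigma.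
Proof. by rewrite /= tsubst_chr_store -map_comp; congr cons; apply: eq_map. Qed.

Lemma mem_ground_goal_delta (sigma : state C Q R) t :
  (Delta t \in ground_goal sigma) = (t == chr_store (delta sigma)).
Proof.
rewrite inE; apply/orP/eqP => [[/eqP[]//|/mapP[]//]|->].
by left.
Qed.

Lemma mem_ground_goal_gamma (sigma : state C Q R) b c r :
  (Gamma (Cst b) (Cst c) (Num r) \in ground_goal sigma) =
  ((gamma sigma).[? b] == Some (c, r)).
Proof.
rewrite inE /= -mem_graph_of; apply/mapP/idP => [[[b' [c' r']] h]|h].
  by case=> -> -> ->.
by exists (b, (c, r)).
Qed.

Lemma mem_ground_goalP (sigma : state C Q R) x y z :
  Gamma x y z \in ground_goal sigma ->
  exists b c r, [/\ x = Cst b, y = Cst c, z = Num r &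
                    (gamma sigma).[? b] = Some (c, r)].
Proof.
rewrite inE /= => /mapP[[b [c r]] h [/= -> -> ->]]; exists b, c, r; split=> //.
by apply/eqP; rewrite -mem_graph_of.
Qed.

(** The goal recovers the chunk store and the cognitive state; the additional information lives in
    the built-in store and has to be recovered by other means. *)
Lemma ground_goal_inj (s s' : state C Q R) :
  perm_eq (ground_goal s) (ground_goal s') ->
  delta s = delta s' /\ gamma s = gamma s'.
Proof.
move=> /perm_mem p; split.
  apply/eqP; rewrite -(inj_eq (@chr_store_inj void)) -mem_ground_goal_delta -p.
  by rewrite mem_ground_goal_delta.
have e b : forall c, (gamma s).[? b] == Some c = ((gamma s').[? b] == Some c).
  by case=> c r; rewrite -!mem_ground_goal_gamma p.
apply/fmapP => b; case gb: (gamma s).[? b] => [c|].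
  by apply/esym/eqP; rewrite -e gb.
by case gb': (gamma s').[? b] => [c|//]; have := e b c; rewrite gb gb' eqxx.
Qed.

Lemma bsvars_chr_info (X : choiceType) u :
  bsvars (@chr_info d C Q R X u) = [::].
Proof.
rewrite /bsvars /chr_info -map_comp; elim: (enum_fset u) => //= a s ->.
by rewrite cats0; elim: a.2 => //= t l; rewrite tvars_of_ground.
Qed.

Lemma holds_chr_info (X : choiceType) (I : interpretation C Q R)
    (eta : X -> ground_term C R) u :
  holds I eta (chr_info u) <-> info_holds I u.
Proof.
have e a : bsubst eta (BInfo a.1 [seq of_ground X t | t <- a.2]) =
           BInfo a.1 a.2 :> builtin C Q R void.
  rewrite /=; congr BInfo; rewrite -map_comp -[RHS]map_id.
  by apply: eq_map => t /=; rewrite of_groundK.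
rewrite /info_holds /chr_info; split=> h.
  move=> a au; have {au} : a \in enum_fset u by [].
  elim: (enum_fset u) h => //= b s ih [hb hs].
  by rewrite inE => /predU1P[->|/(ih hs)//]; move: hb; rewrite -map_comp
    (eq_map (@of_groundK _ _ _ eta)) map_id.
have {}h : forall a, a \in enum_fset u -> i_info I a.1 a.2 by exact: h.
elim: (enum_fset u) h => //= b s ih h; split; last first.
  by apply: ih => a' a's; apply: h; rewrite inE a's orbT.
by rewrite -map_comp (eq_map (@of_groundK _ _ _ eta)) map_id; apply: h;
  rewrite mem_head.
Qed.

(** * The least model *)

Section LeastModel.
Variables (A : architecture C Q R) (u w : information C Q R).
Variable out : outcome_choice (C := C) (Q := Q) (R := R).

(** Each built-in holds only where a clause of [ct_model] demands it. In particular [i_action]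
    succeeds only on a chosen outcome that belongs to I(alpha, sigma) and whose information is
    contained in [w]. *)
Definition least_model : interpretation C Q R :=
  {| i_action := fun a D G Dr Cr Er => exists k b t l D0 g c r,
       let al := (k, (b, t, [fset p in l])) in let e := out al D0 g in
       [/\ a = ground_action_term k b t l, D = chr_store D0 & G = chr_gamma g]
       /\ [/\ abstract_state A (State D0 g u),
              interp_action A (State D0 g u) al e &
              (e_gamma e).[? b] = Some (c, r)]
       /\ [/\ Dr = chr_store (e_delta e), Cr = Cst c, Er = Num r &
              e_info e `<=` w];
     i_merge := fun t D => exists2 Ds,
       t = list_term [seq chr_store D0 | D0 <- Ds] &
       D = chr_store (merge_all (merge_op A) Ds);
     i_map := fun t t' x y => exists D D' c,
       [/\ t = chr_store D, t' = chr_store D', x = Cst c &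
           y = Cst (mrg_map (merge_op A) D D'
                     (if c \in domf D then inl c
                      else if c \in domf D' then inr c
                      else inl (nil_id A)))];
     i_info := fun q l => (q, l) \in w |}.

Lemma info_holds_least_model v : info_holds least_model v <-> v `<=` w.
Proof.
by split=> [h|/fsubsetP h [q l]]; [apply/fsubsetP => -[q l] /h|exact: h].
Qed.

(** The existentially quantified arguments in the model are identified with the actual ones by
    injectivity of the encodings. *)
Lemma least_model_ct : ct_model A u out least_model.
Proof.
split=> [k b t l D g e c r ab ie eE gb Dr Cr Er|Ds D|D D' c C'].
- subst e; split.
    case=> [[k0 [b0 [t0 [l0 [D0 [g0 [c0 [r0 /= [[]]]]]]]]]]].
    move=> /ground_action_term_inj [<- <- <- <-] /chr_store_inj <-.
    move=> /chr_gamma_inj <- [[_ _ gb0] [-> -> -> sub]] hu.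
    move: gb0; rewrite gb => -[<- <-]; split=> //.
    exact/info_holds_least_model.
  case=> -> -> -> hu /info_holds_least_model sub; split=> //=.
  by exists k, b, t, l, D, g, c, r; split=> //; split=> //; split.
- split=> [[Ds' /list_term_inj/(inj_map (@chr_store_inj void)) -> //]|->].
  by exists Ds.
- split=> [[D0 [D0' [c0 [/chr_store_inj<- /chr_store_inj<- [<-] ->//]]]]|->].
  by exists D, D', c.
Qed.

End LeastModel.

End Encodings.

(** * Valuations of a translated rule *)

Lemma fnd_fmap_in (K : choiceType) T (B : {fset K}) (F : B -> T) k
    (kB : k \in B) :
  [fmap x : B => F x].[? k] = Some (F [` kB]).
Proof. by rewrite in_fnd ffunE. Qed.

Lemma rule_varsE (C Q X : choiceType) (R : realType)
    (r : chr_rule C Q R X) x :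
  (x \in rule_vars r) =
  [|| x \in csvars (kept r), x \in csvars (removed r), x \in bsvars (guard r),
      x \in csvars (body_chr r) | x \in bsvars (body_builtin r)].
Proof. by rewrite /rule_vars !mem_cat. Qed.

Lemma bsvars_flatten_mapP (C Q X : choiceType) (R : realType) (I : eqType)
    (F : I -> seq (builtin C Q R X)) s x :
  x \in bsvars (flatten (map F s)) -> exists2 i, i \in s & x \in bsvars (F i).
Proof.
elim: s => //= i s ih; rewrite bsvars_cat mem_cat => /orP[xi|/ih[j js xj]].
  by exists i; rewrite ?mem_head.
by exists j; rewrite // inE js orbT.
Qed.

Lemma mem_bsvars_cat (C Q X : choiceType) (R : realType)
    (B B' : seq (builtin C Q R X)) x :
  x \in bsvars (B ++ B') -> x \in bsvars B \/ x \in bsvars B'.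
Proof. by rewrite bsvars_cat mem_cat => /orP. Qed.

(** * Combined effects *)

Section Effects.
Context {d : Order.disp_t} {C : orderType d} {V Q : choiceType} {R : realType}.
Variable A : architecture C Q R.

(** Modifications and requests differ here only in the delay: both place a chunk under the fresh
    identifier of their buffer. *)
Lemma interp_action_gamma sigma a e : interp_action A sigma a e ->
  exists x, e_gamma e =
    [fmap].[pat_buffer a.2 <- (fresh A (pat_buffer a.2) (delta sigma), x)].
Proof.
case=> [b t P c r val0 val _ _ _ _ _|b t P x t' val r u X _ _ _].
  by exists 0%R.
by exists (if (0 < r)%R then 1%R else 0%R).
Qed.

(** Merging renames chunks but leaves delays alone, so delays can be followed without knowing how
    identifiers are mapped. *)
Lemma delay_combine (e f : effect C Q R) b :
  omap snd (e_gamma (combine A e f)).[? b] =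
  if omap snd (e_gamma e).[? b] is Some x then Some x
  else omap snd (e_gamma f).[? b].
Proof.
rewrite /combine /=.
have [bi|] := boolP (b \in domf (e_gamma e) `|` domf (e_gamma f)).
  rewrite (fnd_fmap_in _ bi) /=; case eb: (e_gamma e).[? b] => [[c x]|] //=.
  case fb: (e_gamma f).[? b] => [[c x]|] //=.
  by move: bi; rewrite inE => /orP[] h; [move: eb|move: fb]; rewrite in_fnd.
move=> bn; rewrite [in LHS]not_fnd //; move: bn.
by rewrite inE negb_or => /andP[/not_fnd-> /not_fnd->].
Qed.

Lemma delay_combine_all (es : seq (effect C Q R)) b :
  omap snd (e_gamma (combine_all A es)).[? b] =
  ohead (pmap (fun e => omap snd (e_gamma e).[? b]) es).
Proof.
case: es => [|e es]; first by rewrite /= fnd_fmap0.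
rewrite /combine_all.
elim: es e => [|f es ih] e /=; first by case: (_.[? b]).
rewrite ih /= delay_combine.
by case: ((e_gamma e).[? b]) => [x|] //=; case: ((e_gamma f).[? b]).
Qed.

Lemma delta_combine_all (es : seq (effect C Q R)) :
  e_delta (combine_all A es) =
  merge_all (merge_op A) (map (@e_delta _ _ _ _) es).
Proof.
case: es => //= e es; elim: es e => //= f es ih e; exact: ih.
Qed.

Lemma info_combine_all (es : seq (effect C Q R)) I :
  info_holds I (e_info (combine_all A es)) <->
  forall e, List.In e es -> info_holds I (e_info e).
Proof.
have cup (v w : information C Q R) :
    info_holds I (v `|` w) <-> info_holds I v /\ info_holds I w.
  split=> [h|[hv hw] a]; last by rewrite inE => /orP[/hv|/hw].
  by split=> a ai; apply: h; rewrite inE ai ?orbT.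
case: es => [|e es] /=; first by split=> [|_ a]; rewrite ?inE.
elim: es e => [|f es ih] e /=; first by split=> [h _ [<-//|//]|]; apply; left.
rewrite ih; split=> [h g [<-|[<-|ges]]|h g [<-|ges]].
- by have /cup[] := h _ (or_introl erefl).
- by have /cup[] := h _ (or_introl erefl).
- exact: h (or_intror ges).
- by apply/cup; split; apply: h; auto.
- by apply: h; auto.
Qed.

End Effects.

(** * The variables of a translated rule *)

Section ApplyRule.
Context {d : Order.disp_t} {C : orderType d} {V Q : choiceType} {R : realType}.
Local Notation chr_var := (@chr_var d C V).
Local Notation gterm := (ground_term C R).
Variables (A : architecture C Q R) (r : rule C V) (sigma : state C Q R).
Hypotheses (r_ok : actr_rule A r) (sigma_ok : abstract_state A sigma).

Local Notation D0 := (delta sigma).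
Local Notation g0 := (gamma sigma).
Local Notation u0 := (info sigma).
Local Notation cr := (chr_of_rule (Q := Q) (R := R) A r).
Local Notation abufs := [seq pat_buffer a.2 | a <- actions_of r].
Local Notation bufs := (sorted_fset (buffers A)).

Lemma mem_actions_of a : (a \in actions_of r) = (a \in r.2).
Proof. by rewrite /actions_of mem_sort. Qed.

Lemma action_buffer_inj :
  {in actions_of r &,
    injective (fun a : action C (C + V)%type => pat_buffer a.2)}.
Proof.
by move=> a a'; rewrite !mem_actions_of; case: r_ok => _ _ h _; exact: h.
Qed.

Lemma uniq_abufs : uniq abufs.
Proof.
rewrite map_inj_in_uniq; last exact: action_buffer_inj.
by rewrite /actions_of sort_uniq fset_uniq.
Qed.

Lemma sub_abufs : {subset abufs <= buffers A}.
Proof.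
move=> _ /mapP[[k [[b t] P]] + ->]; rewrite mem_actions_of => ar.
by case: r_ok => _ /(_ k b t P ar) [].
Qed.

Definition buffer_value b : C * R := odflt (nil_id A, 0%R) g0.[? b].

Lemma buffer_valueP b : b \in buffers A -> g0.[? b] = Some (buffer_value b).
Proof.
move=> bb; have bg : b \in domf g0 by case: sigma_ok => _ e _; rewrite e.
by rewrite /buffer_value in_fnd.
Qed.

Lemma graph_gamma : graph_of g0 = [seq (b, buffer_value b) | b <- bufs].
Proof.
case: (sigma_ok) => _ dg _.
have -> : bufs = sorted_fset (domf g0) by rewrite dg.
apply: graph_of_total => b bg; apply: buffer_valueP; by rewrite -dg.
Qed.

(** The variables of the rule by kind, so that equality of two valuations on them can be checked one
    kind at a time. *)
Inductive occurring : chr_var -> Prop :=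
| OccD : occurring var_D
| OccD' : occurring var_D'
| OccDstar : occurring var_Dstar
| OccCvar b : b \in buffers A -> occurring (cvar b)
| OccDvar b : b \in buffers A -> occurring (dvar b)
| OccResstore b : b \in abufs -> occurring (resstore b)
| OccResid b : b \in abufs -> occurring (resid b)
| OccResdelay b : b \in abufs -> occurring (resdelay b)
| OccMergeid b : b \in abufs -> occurring (mergeid b)
| OccActr x q : q \in r.1 -> in_vars x q.2 -> occurring (actr_var x).

Lemma mem_tvars_pattern P y :
  y \in tvars (pattern_term P : term C R chr_var) ->
  exists2 x, in_vars x P & y = actr_var x.
Proof.
rewrite /pattern_term tvars_pairs_term -map_comp => /flatten_mapP[[s v]].
rewrite mem_sort => sP /=; case: v sP => [c|x] sP //=; rewrite inE => /eqP->.
by exists x => //; exists s.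
Qed.

Lemma mem_head_vars x : x \in csvars (removed cr) ->
  x = var_D \/ exists2 b, b \in buffers A & x = cvar b \/ x = dvar b.
Proof.
rewrite /= /csvars /= inE => /predU1P[->|]; first by left.
rewrite -map_comp => /flatten_mapP[b].
rewrite mem_sorted_fset => bb /=; rewrite !inE => h; right; exists b => //.
by case/orP: h => /eqP; auto.
Qed.

Lemma cogstate_vars y :
  y \in tvars (cogstate_term (buffers A) : term C R chr_var) ->
  exists2 b, b \in buffers A & y = cvar b \/ y = dvar b.
Proof.
rewrite /cogstate_term tvars_pairs_term -map_comp => /flatten_mapP[b].
rewrite mem_sorted_fset => bb /=; rewrite !inE => h; exists b => //.
by case/orP: h => /eqP; auto.
Qed.

(** ACT-R variables of actions also occur in tests, so [OccActr] covers them. *)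
Lemma mem_rule_vars x : x \in rule_vars cr -> occurring x.
Proof.
have [tests_ok acts_ok _ vars_ok] := r_ok.
have occ_cog y : (exists2 b, b \in buffers A & y = cvar b \/ y = dvar b) ->
    occurring y.
  by case=> b bb [->|->]; constructor.
rewrite rule_varsE => /or4P[|/mem_head_vars[->|]||/orP[]]; first by [].
- exact: OccD.
- exact: occ_cog.
- case/bsvars_flatten_mapP => -[[b t] P] tr.
  have [bb _] := tests_ok b t P tr; rewrite /bsvars /= inE !mem_cat !inE.
  case/or3P => [/eqP->|/orP[/mem_tvars_pattern[y yP ->]|/eqP->]|/eqP->];
    try by constructor.
  exact: OccActr tr yP.
- rewrite /= /csvars /= inE => /predU1P[->|]; first by constructor.
  rewrite map_cat flatten_cat mem_cat -!map_comp => /orP[] /flatten_mapP[b].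
    move/(map_f (fun a => pat_buffer a.2)) => ba /=; rewrite !inE.
    by case/orP=> /eqP->; constructor.
  rewrite mem_filter mem_sorted_fset => /andP[_ bb] /=; rewrite !inE => h.
  by apply: occ_cog; exists b => //; case/orP: h => /eqP; auto.
- case/mem_bsvars_cat => [|/mem_bsvars_cat[]].
  + rewrite /bsvars -map_comp => /flatten_mapP[[k [[b t] P]] ain /=].
    have ba : b \in abufs by apply/mapP; exists (k, (b, t, P)).
    rewrite !(mem_cat, inE) => /or4P[].
    * case/mem_tvars_pattern => y yP ->.
      have [|q qr yq] := vars_ok y (k, (b, t, P)) _ yP.
        by rewrite -mem_actions_of.
      exact: OccActr qr yq.
    * by move/eqP->; constructor.
    * by move=> h; apply: occ_cog; apply: cogstate_vars.
    * by case/or3P => /eqP->; constructor.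
  + rewrite /bsvars /= mem_cat tvars_list_term -!map_comp mem_cat.
    case/orP => [/orP[/flatten_mapP[b]|]|]; last first.
    * by rewrite !inE => /or3P[]/eqP->; constructor.
    * by rewrite inE => /eqP->; constructor.
    * move/(map_f (fun a => pat_buffer a.2)) => ba /=.
      by rewrite inE => /eqP->; constructor.
  + rewrite /bsvars -!map_comp => /flatten_mapP[b].
    move/(map_f (fun a => pat_buffer a.2)) => ba; rewrite /= !inE.
    by case/or4P => /eqP->; constructor.
Qed.

End ApplyRule.

Section BuiltinLists.
Context {C Q X : choiceType} {R : realType}.
Variables (I : interpretation C Q R) (eta : X -> ground_term C R).

Lemma holds_map (T : eqType) (F : T -> builtin C Q R X) s :
  holds I eta (map F s) <->
  forall i, i \in s -> ground_holds I (bsubst eta (F i)).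
Proof.
elim: s => [|i s ih] /=; first by split.
rewrite ih; split=> [[hi hs] j|h]; first by rewrite inE => /predU1P[->|/hs].
by split=> [|j js]; apply: h; rewrite inE ?eqxx // js orbT.
Qed.

Lemma holds_flatten_map (T : eqType) (F : T -> seq (builtin C Q R X)) s :
  holds I eta (flatten (map F s)) <-> forall i, i \in s -> holds I eta (F i).
Proof.
elim: s => [|i s ih] /=; first by split.
rewrite holds_cat ih; split=> [[hi hs] j|h].
  by rewrite inE => /predU1P[->|/hs].
by split=> [|j js]; apply: h; rewrite inE ?eqxx // js orbT.
Qed.

End BuiltinLists.

(** * Patterns of tests and actions *)

Section Patterns.
Context {d : Order.disp_t} {C : orderType d} {V : choiceType} {R : realType}.
Local Notation chr_var := (@chr_var d C V).
Local Notation gterm := (ground_term C R).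
Implicit Types (theta : substitution (C := C) (V := V)).
Implicit Types (zeta : chr_var -> gterm) (P : {fset C * (C + V)}).

Local Notation sorted_pairs P :=
  (sort (fun p q : C * (C + V) => p.1 <= q.1)%O (enum_fset P)).

Lemma tmem_chr_store i t (l : seq (C * gterm)) (D : store C) :
  tmem (ChunkT (Cst i) (Cst t) (pairs_term l)) (chr_store D) <->
  exists2 val, D.[? i] = Some (t, val) &
               l = [seq (q.1, Cst q.2) | q <- graph_of val].
Proof.
rewrite /chr_store tmem_list_term; split.
  case/List.in_map_iff => -[i' [t' val]] /= [[-> -> /pairs_term_inj l_eq]] h.
  exists val => //; apply/eqP; rewrite -mem_graph_of.
  exact/mem_In.
case=> val /eqP; rewrite -mem_graph_of => /mem_In h ->.
by apply/List.in_map_iff; exists (i, (t, val)).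
Qed.

Lemma tsubst_pattern_term zeta P :
  tsubst zeta (pattern_term P) =
  pairs_term [seq (p.1, tsubst zeta (value_term p.2)) | p <- sorted_pairs P].
Proof. by rewrite /pattern_term tsubst_pairs_term -map_comp. Qed.

(** The instantiated pairs as a list: the action term keeps its order and repetitions, which
    [subst_action] forgets. *)
Definition action_pairs theta P :
    seq (C * C) :=
  pmap (fun p => omap (pair p.1) (subst_value theta p.2)) (sorted_pairs P).

Lemma subst_action_pairs theta k b t P :
  subst_action theta (k, (b, t, P)) =
  (k, (b, t, [fset q in action_pairs theta P])).
Proof.
rewrite /subst_action /=; congr (_, (_, _, _)); apply/fsetP => q.
rewrite !inE /action_pairs !mem_pmap.
by apply/mapP/mapP => -[p pP ->]; exists p => //; move: pP; rewrite mem_sort.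
Qed.

Lemma tsubst_pattern_pairs theta zeta P :
  (forall x, in_vars x P ->
     exists2 c, theta.[? x] = Some c & zeta (actr_var x) = Cst c) ->
  tsubst zeta (pattern_term P) =
  pairs_term [seq (q.1, Cst q.2) | q <- action_pairs theta P].
Proof.
move=> h; rewrite tsubst_pattern_term /action_pairs; congr pairs_term.
have: {subset sorted_pairs P <= P} by move=> p; rewrite mem_sort.
elim: (sorted_pairs P) => //= -[s v] l ih sub.
rewrite ih; last by move=> p pl; apply: sub; rewrite inE pl orbT.
case: v sub => [c|x] sub //=.
have [|c -> ->//] := h x; exists s; apply: sub; exact: mem_head.
Qed.

(* In set normal form a test lists every slot exactly once, so its sorted
   pattern is the graph of the chunk it matches. *)
Lemma pattern_graph zeta P (val : {fmap C -> C}) :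
  (forall s, s \in domf val -> exists! v, (s, v) \in P) ->
  (forall s v, (s, v) \in P ->
     exists2 x, val.[? s] = Some x & tsubst zeta (value_term v) = Cst x) ->
  [seq (p.1, tsubst zeta (value_term p.2)) | p <- sorted_pairs P] =
  [seq (q.1, Cst q.2) | q <- graph_of val].
Proof.
move=> snf h.
have inP p : (p \in sorted_pairs P) = (p \in P) by rewrite mem_sort.
(* Both lists of slot names are sorted, so it suffices that they have the same elements without
   repetition; set normal form supplies a value for each slot and excludes a second one. *)
have keys : map fst (sorted_pairs P) = sorted_fset (domf val).
  apply: (sorted_eq le_trans le_anti).
  - rewrite sorted_map; apply: sort_sorted => p q; exact: le_total.
  - by apply: sort_sorted; exact: le_total.
  apply: uniq_perm; first 1 last.
  - exact: uniq_sorted_fset.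
  - move=> s; rewrite mem_sorted_fset; apply/mapP/idP => [[[s' v]]|sv].
      by rewrite inP => /h[x + _ ->]; case: fndP.
    by have [v [vP _]] := snf s sv; exists (s, v); rewrite ?inP.
  rewrite map_inj_in_uniq ?sort_uniq ?fset_uniq // => -[s v] [s' v'].
  rewrite !inP /= => vP v'P e; rewrite -{s'}e in v'P *.
  have sv : s \in domf val by have [x] := h _ _ vP; case: fndP.
  by have [w [_ wu]] := snf s sv; rewrite -(wu v) // -(wu v').
pose F k : gterm := if val.[? k] is Some x then Cst x else Nil.
transitivity [seq (k, F k) | k <- map fst (sorted_pairs P)].
  rewrite -map_comp; apply/eq_in_map => -[s v]; rewrite inP => /h[x sx vx].
  by rewrite /= vx /F sx.
rewrite keys -fst_graph_of -map_comp; apply/eq_in_map => -[s x].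
by rewrite mem_graph_of /= /F => /eqP->.
Qed.

End Patterns.

(** * The valuation that solves a rule *)

Section Valuation.
Context {d : Order.disp_t} {C : orderType d} {V Q : choiceType} {R : realType}.
Local Notation chr_var := (@chr_var d C V).
Local Notation gterm := (ground_term C R).
Variables (A : architecture C Q R) (r : rule C V) (sigma : state C Q R).
Hypotheses (r_ok : actr_rule A r) (r_snf : set_normal_form A r).
Hypothesis sigma_ok : abstract_state A sigma.
Variables (theta : substitution (C := C) (V := V)).
Variable out : outcome_choice (C := C) (Q := Q) (R := R).

Local Notation D0 := (delta sigma).
Local Notation g0 := (gamma sigma).
Local Notation u0 := (info sigma).
Local Notation cr := (chr_of_rule (Q := Q) (R := R) A r).
Local Notation acts := (actions_of r).
Local Notation abufs := [seq pat_buffer a.2 | a <- acts].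
Local Notation bufs := (sorted_fset (buffers A)).
Local Notation gval := (buffer_value A sigma).
Implicit Types (I : interpretation C Q R) (zeta : chr_var -> gterm).

Definition head_ok zeta : Prop :=
  zeta var_D = chr_store D0 /\
  forall b, b \in buffers A ->
    zeta (cvar b) = Cst (gval b).1 /\ zeta (dvar b) = Num (gval b).2.

Definition agree zeta : Prop :=
  forall x q, q \in r.1 -> in_vars x q.2 ->
    exists2 c, theta.[? x] = Some c & zeta (actr_var x) = Cst c.

Lemma head_goal zeta : head_ok zeta ->
  map (csubst zeta) (removed cr) = ground_goal sigma.
Proof.
case=> zD zb; rewrite /= zD /ground_goal (graph_gamma sigma_ok) -!map_comp.
congr cons; apply/eq_in_map => b; rewrite mem_sorted_fset => /zb [/= -> ->].
by [].
Qed.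

Lemma holds_guard I zeta :
  holds I zeta (guard cr) <->
  forall q, q \in r.1 -> holds I zeta (test_guard q).
Proof. exact: holds_flatten_map. Qed.

(** Membership in the store term is equality with one of its chunk terms, so every pair of the
    pattern appears among the slots of the chunk in the buffer. *)
Lemma guard_match I zeta b t P :
  head_ok zeta -> (b, t, P) \in r.1 -> holds I zeta (test_guard (b, t, P)) ->
  exists2 val, g0.[? b] = Some ((gval b).1, 0%R) /\
               D0.[? (gval b).1] = Some (t, val) &
  forall s v, (s, v) \in P ->
    exists2 x, val.[? s] = Some x & tsubst zeta (value_term v) = Cst x.
Proof.
case=> zD zb tr; have [bb _] : b \in buffers A /\ is_type A t.
  by case: r_ok => h _ _ _; exact: h tr.
have [zc zd] := zb b bb.
rewrite [holds _ _ _]/= zD zc zd tsubst_pattern_term => -[].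
move=> /tmem_chr_store[val Dc e] [[dl] _]; exists val.
  by split=> //; rewrite (buffer_valueP sigma_ok bb) -dl; case: (gval b).
move=> s v sP; have : (s, tsubst zeta (value_term v)) \in
    [seq (q.1, Cst q.2) | q <- graph_of val].
  by rewrite -e; apply/mapP; exists (s, v); rewrite ?mem_sort.
by case/mapP => -[s' x]; rewrite mem_graph_of => /eqP h /= [-> ->]; exists x.
Qed.

(** This is where set normal form enters: a match speaks of the slots listed in the test, whereas
    [in] compares the pattern with the whole slot list of the chunk. *)
Lemma match_guard I zeta b t P :
  head_ok zeta -> (b, t, P) \in r.1 -> matches theta r sigma -> agree zeta ->
  holds I zeta (test_guard (b, t, P)).
Proof.
case=> zD zb tr th ag; have [bb _] : b \in buffers A /\ is_type A t.
  by case: r_ok => h _ _ _; exact: h tr.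
have [zc zd] := zb b bb; have [c [val [gb Dc h]]] := th b t P tr.
have gv : gval b = (c, 0%R) by rewrite /buffer_value gb.
rewrite [holds _ _ _]/= zD zc zd tsubst_pattern_term gv /=; split=> //.
apply/tmem_chr_store; exists val => //; apply: pattern_graph => [s sv|s v sP].
  apply: (r_snf tr); case: (sigma_ok) => -[chs _] _ _.
  by have [_ <- _] := chs _ _ _ Dc.
have [x sx vx] := h s v sP; exists x => //.
case: v sP vx => [c' _ [->]//|y sP /= ty].
by have [|c' ] := ag y _ tr; [exists s|rewrite ty => -[->]].
Qed.

(** Guard and match read each variable from the same slot of the same chunk. As this holds for every
    matching [theta], it also yields minimality of the bindings. *)
Lemma match_agree I zeta :
  head_ok zeta -> holds I zeta (guard cr) -> matches theta r sigma ->
  agree zeta.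
Proof.
move=> hz /holds_guard hg th x [[b t] P] tr [s sP].
have [val [gb Dc] h] := guard_match hz tr (hg _ tr).
have [c' [val' [gb' Dc' h']]] := th b t P tr.
move: gb' Dc' h'; rewrite gb => -[<-]; rewrite Dc => -[<-] h'.
have [y sy zx] := h _ _ sP; have [y' sy' tx] := h' _ _ sP.
by exists y => //; move: sy'; rewrite sy => -[->].
Qed.

Definition action_effect (a : action C (C + V)%type) : effect C Q R :=
  out (subst_action theta a) D0 g0.

(** CHR variables are indexed by buffers, so the action has to be found from its buffer; a rule has
    at most one action on each. *)
Definition action_on b : action C (C + V)%type :=
  nth (Modify, (b, b, fset0)) acts (find (fun a => pat_buffer a.2 == b) acts).

Lemma action_on_buffer a : a \in acts -> action_on (pat_buffer a.2) = a.
Proof.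
move=> ain; have h : has (fun a' => pat_buffer a'.2 == pat_buffer a.2) acts.
  by apply/hasP; exists a.
apply: (action_buffer_inj r_ok) => //; first by rewrite mem_nth // -has_find.
exact/eqP/(nth_find _ h).
Qed.

Definition delay_on b : R :=
  odflt 0%R (omap snd (e_gamma (action_effect (action_on b))).[? b]).

Definition total_effect : effect C Q R :=
  combine_all A (map action_effect acts).

Hypothesis theta_ok : matches theta r sigma.
Hypothesis effects_ok : forall a, a \in acts ->
  interp_action A sigma (subst_action theta a) (action_effect a).
Hypothesis kept_ok : forall b c x,
  (e_gamma total_effect).[? b] = Some (c, x) ->
  c = fresh A b D0 /\ c \in domf (e_delta total_effect).

Lemma effect_gamma a : a \in acts ->
  e_gamma (action_effect a) = [fmap].[pat_buffer a.2 <-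
    (fresh A (pat_buffer a.2) D0, delay_on (pat_buffer a.2))].
Proof.
move=> ain; have [x e] := interp_action_gamma (effects_ok ain).
by rewrite e /delay_on action_on_buffer // e fnd_set eqxx.
Qed.

(** The delay comes from the effect of the single action on [b], since combining keeps delays; the
    identifier comes from [kept_ok]. *)
Lemma total_gamma b : (e_gamma total_effect).[? b] =
  if b \in abufs then Some (fresh A b D0, delay_on b) else None.
Proof.
have := delay_combine_all A (map action_effect acts) b; rewrite -/total_effect.
have -> : ohead (pmap (fun e : effect C Q R => omap snd (e_gamma e).[? b])
     (map action_effect acts)) =
     if b \in abufs then Some (delay_on b) else None.
  have: {subset acts <= acts} by [].
  elim: {1 3 4}acts => //= a s ih sub.
  rewrite effect_gamma ?sub ?mem_head // fnd_set fnd_fmap0 inE.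
  case: eqP => [->//|_] /=; apply: ih => a' a's.
  by apply: sub; rewrite inE a's orbT.
case e: (_.[? b]) => [[c x]|] /=; case: ifP => // _ [->].
by have [->] := kept_ok e.
Qed.

(** The values that the apply transition computes; the last family, [mergeid], gives the image of
    the fresh chunk in the merged store. *)
Definition valuation (x : chr_var) : gterm :=
  match x with
  | inl (inl v) => if theta.[? v] is Some c then Cst c else Nil
  | inl (inr (0, b)) => Cst (gval b).1
  | inl (inr (1, b)) => Num (gval b).2
  | inl (inr (2, b)) => chr_store (e_delta (action_effect (action_on b)))
  | inl (inr (3, b)) => Cst (fresh A b D0)
  | inl (inr (4, b)) => Num (delay_on b)
  | inl (inr (_, b)) => Cst (mrg_map (merge_op A) D0 (e_delta total_effect)
                               (inr (fresh A b D0)))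
  | inr 0 => chr_store D0
  | inr 1 => chr_store (e_delta total_effect)
  | inr _ => chr_store (mrg (merge_op A) D0 (e_delta total_effect))
  end.

Lemma head_ok_valuation : head_ok valuation.
Proof. by []. Qed.

Lemma agree_valuation : agree valuation.
Proof.
move=> x [[b t] P] tr [s sP]; have [c [val [_ _ h]]] := theta_ok tr.
by have [y _ tx] := h _ _ sP; exists y => //=; rewrite [theta.[? x]]tx.
Qed.

Lemma valuation_guard I : holds I valuation (guard cr).
Proof.
apply/holds_guard => -[[b t] P] tr.
apply: match_guard tr theta_ok agree_valuation; exact: head_ok_valuation.
Qed.

(** * Solving the built-ins of the body *)

Section Body.
Variables (I : interpretation C Q R) (zeta : chr_var -> gterm).
Hypotheses (I_ct : ct_model A u0 out I) (I_info : info_holds I u0).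
Hypotheses (zeta_head : head_ok zeta) (zeta_agree : agree zeta).

Lemma tsubst_cogstate : tsubst zeta (cogstate_term (buffers A)) = chr_gamma g0.
Proof.
rewrite /cogstate_term tsubst_pairs_term /chr_gamma (graph_gamma sigma_ok).
rewrite -!map_comp; congr pairs_term; apply/eq_in_map => b.
by rewrite mem_sorted_fset /= => /zeta_head.2[-> ->].
Qed.

Lemma tsubst_action_term k b t P : (k, (b, t, P)) \in acts ->
  tsubst zeta (ActT k (Cst b) (Cst t) (pattern_term P)) =
  ground_action_term k b t (action_pairs theta P).
Proof.
move=> ain; rewrite /= (@tsubst_pattern_pairs _ _ _ _ theta) //.
move=> x xP; have [_ _ _ h] := r_ok.
have [|q qr xq] := h x (k, (b, t, P)) _ xP; first by rewrite -mem_actions_of.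
exact: zeta_agree qr xq.
Qed.

(** [ct_action] characterizes the built-in only in conjunction with the additional information of
    the state; [I_info] lets that conjunct be added and removed. *)
Lemma action_holds k b t P : (k, (b, t, P)) \in acts ->
  i_action I (ground_action_term k b t (action_pairs theta P)) (chr_store D0)
    (chr_gamma g0) (zeta (resstore b)) (zeta (resid b)) (zeta (resdelay b)) <->
  [/\ zeta (resstore b) = valuation (resstore b),
      zeta (resid b) = valuation (resid b),
      zeta (resdelay b) = valuation (resdelay b) &
      info_holds I (e_info (action_effect (k, (b, t, P))))].
Proof.
move=> ain; have ie := effects_ok ain.
have sE : sigma = State D0 g0 u0 by case: (sigma).
have onb : action_on b = (k, (b, t, P)) := action_on_buffer ain.
have gb : (e_gamma (action_effect (k, (b, t, P)))).[? b] =
          Some (fresh A b D0, delay_on b).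
  by rewrite effect_gamma // fnd_set eqxx.
have ab : abstract_state A (State D0 g0 u0) by rewrite -sE.
rewrite subst_action_pairs {1}sE in ie.
have eE : action_effect (k, (b, t, P)) =
    out (k, (b, t, [fset q in action_pairs theta P])) D0 g0.
  by rewrite /action_effect subst_action_pairs.
have ct := ct_action I_ct ab ie eE gb; rewrite /= onb.
split=> [ia|[zs zi zd hi]].
  by have [-> -> -> _ hi] := (ct _ _ _).1 (conj ia I_info).
by have [] := (ct _ _ _).2 (And5 zs zi zd I_info hi).
Qed.

(** The body is a triangular system: the actions fix the result variables, from these the two merges
    fix D' and D*, and from all of them the maps fix the merged identifiers. *)
Lemma holds_body : holds I zeta (body_builtin cr) <->
  [/\ forall b, b \in abufs ->
        [/\ zeta (resstore b) = valuation (resstore b),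
            zeta (resid b) = valuation (resid b),
            zeta (resdelay b) = valuation (resdelay b) &
            zeta (mergeid b) = valuation (mergeid b)],
      zeta var_D' = valuation var_D',
      zeta var_Dstar = valuation var_Dstar &
      info_holds I (e_info total_effect)].
Proof.
have zD : zeta var_D = chr_store D0 by case: zeta_head.
rewrite -[body_builtin cr]/(_ ++ [:: _; _] ++ _) !holds_cat !holds_map.
have act_iff : (forall a, a \in acts -> ground_holds I (bsubst zeta
      (let: (k, (b, t, P)) := a in
        BAction (ActT k (Cst b) (Cst t) (pattern_term P)) (Var var_D)
          (cogstate_term (buffers A)) (Var (resstore b)) (Var (resid b))
          (Var (resdelay b))))) <->
    (forall b, b \in abufs ->
       [/\ zeta (resstore b) = valuation (resstore b),
           zeta (resid b) = valuation (resid b) &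
           zeta (resdelay b) = valuation (resdelay b)]) /\
    info_holds I (e_info total_effect).
  have one k b t P (ain : (k, (b, t, P)) \in acts) :
      ground_holds I (bsubst zeta
        (BAction (ActT k (Cst b) (Cst t) (pattern_term P)) (Var var_D)
          (cogstate_term (buffers A)) (Var (resstore b)) (Var (resid b))
          (Var (resdelay b)))) <->
      [/\ zeta (resstore b) = valuation (resstore b),
          zeta (resid b) = valuation (resid b),
          zeta (resdelay b) = valuation (resdelay b) &
          info_holds I (e_info (action_effect (k, (b, t, P))))].
    rewrite -action_holds // -tsubst_action_term // -tsubst_cogstate -zD.
    by [].
  rewrite info_combine_all; split=> [h|[h hi] [k [[b t] P]] ain].
    split=> [b /mapP[[k [[b' t] P]] ain ->]|
             e /List.in_map_iff[a [<- /mem_In ain]]].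
      by have /one[] := h _ ain.
    by case: a ain => k [[b t] P] ain; have /one[] := h _ ain.
  apply/one => //; have [] := h b; first by apply/mapP; exists (k, (b, t, P)).
  split=> //; apply: hi; apply/List.in_map_iff.
  by exists (k, (b, t, P)); split=> //; apply/mem_In.
rewrite act_iff.
have merge_iff : (forall b, b \in abufs ->
      zeta (resstore b) = valuation (resstore b)) ->
    holds I zeta
      [:: BMerge (list_term [seq Var (resstore b) | b <- abufs]) (Var var_D');
          BMerge (list_term [:: Var var_D; Var var_D']) (Var var_Dstar)] <->
    zeta var_D' = valuation var_D' /\ zeta var_Dstar = valuation var_Dstar.
  move=> h; rewrite [holds _ _ _]/=.
  have -> : tsubst zeta (list_term [seq Var (resstore b) | b <- abufs]) =
      list_term [seq chr_store D | D <-
        map (@e_delta _ _ _ _) (map action_effect acts)].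
    rewrite tsubst_list_term -!map_comp; congr list_term.
    apply/eq_in_map => a ain; rewrite /= h; last by apply/mapP; exists a.
    by rewrite /= action_on_buffer.
  have m1 := ct_merge I_ct (map (@e_delta _ _ _ _) (map action_effect acts))
    (zeta var_D').
  rewrite -delta_combine_all -/total_effect in m1.
  have mr D : i_merge I (Cons (chr_store D0) (Cons (chr_store D) Nil))
      (zeta var_Dstar) <->
      zeta var_Dstar = chr_store (mrg (merge_op A) D0 D).
    exact: (ct_merge I_ct [:: D0; D]).
  rewrite /= zD; split=> [[/m1-> [/mr-> _]]//|[zD' zDs]].
  by split; [apply/m1|split=> //; rewrite zD'; apply/mr].
have map_iff b : b \in abufs -> zeta (resid b) = valuation (resid b) ->
    zeta var_D' = valuation var_D' ->
    ground_holds I (bsubst zeta (BMap (Var var_D) (Var var_D') (Var (resid b))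
      (Var (mergeid b)))) <-> zeta (mergeid b) = valuation (mergeid b).
  move=> ba zr zD'; rewrite /= zr zD' zD /= (ct_map I_ct).
  (* A fresh identifier is not in the old store and, by [kept_ok], is in the merged results, so the
     map built-in takes its second branch. *)
  rewrite (negbTE (fresh_notin A b D0)).
  have gb := total_gamma b; rewrite ba in gb.
  by have [_ ->] := kept_ok gb.
split=> [[[h hi] [hmrg hm]]|[h zD' zDs hi]].
- have hs b : b \in abufs -> zeta (resstore b) = valuation (resstore b).
    by case/h.
  have [zD' zDs] := (merge_iff hs).1 hmrg.
  split=> // b ba; have [? ? ?] := h b ba; split=> //; apply/map_iff => //.
  exact: hm.
- split; first by split=> // b /h[].
  split; first by apply/merge_iff => // b /h[].
  by move=> b ba; apply/map_iff => //; have [] := h b ba.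
Qed.

End Body.

Lemma valuation_body I : ct_model A u0 out I -> info_holds I u0 ->
  info_holds I (e_info total_effect) -> holds I valuation (body_builtin cr).
Proof.
move=> ct hu he; apply/(holds_body ct hu head_ok_valuation agree_valuation).
by [].
Qed.

(** The guard fixes the ACT-R variables through [theta], the head those of the state, and the body
    all others. *)
Lemma valuation_unique I zeta : ct_model A u0 out I -> info_holds I u0 ->
  head_ok zeta -> holds I zeta (guard cr) -> holds I zeta (body_builtin cr) ->
  {in rule_vars cr, zeta =1 valuation} /\ info_holds I (e_info total_effect).
Proof.
move=> ct hu hz hg; have ag := match_agree hz hg theta_ok.
case/(holds_body ct hu hz ag) => h zD' zDs hi; split=> // x.
case/(mem_rule_vars r_ok) => // [|b|b|b|b|b|b|y q qr yq].
- by case: hz.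
- by case/hz.2.
- by case/hz.2.
- by case/h.
- by case/h.
- by case/h.
- by case/h.
- have [c tc ->] := ag _ _ qr yq; by rewrite /= [theta.[? y]]tc.
Qed.

Lemma update_gamma b : b \in buffers A ->
  (gamma (update A sigma total_effect)).[? b] = Some
    (if b \in abufs
     then (mrg_map (merge_op A) D0 (e_delta total_effect) (inr (fresh A b D0)),
           delay_on b)
     else gval b).
Proof.
move=> bb; have bg : b \in domf g0 by case: sigma_ok => _ e _; rewrite e.
rewrite /update [gamma _]/= (fnd_fmap_in _ bg) /= total_gamma.
case: ifP => // _; move: (buffer_valueP sigma_ok bb).
by rewrite in_fnd => -[<-].
Qed.

(** The body lists buffers with an action before the others; together they are the buffers in
    another order, hence the permutation. *)
Lemma body_goal : perm_eq (map (csubst valuation) (body_chr cr))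
  (ground_goal (update A sigma total_effect)).
Proof.
pose F b : constraint C R void :=
  let p := if b \in abufs
     then (mrg_map (merge_op A) D0 (e_delta total_effect) (inr (fresh A b D0)),
           delay_on b)
     else gval b in Gamma (Cst b) (Cst p.1) (Num p.2).
have -> : ground_goal (update A sigma total_effect) =
    Delta (chr_store (mrg (merge_op A) D0 (e_delta total_effect))) ::
    map F bufs.
  rewrite /ground_goal; congr cons.
  have dg : domf (gamma (update A sigma total_effect)) = buffers A.
    by case: sigma_ok.
  rewrite (@graph_of_total _ _ _ _ (fun b => if b \in abufs
     then (mrg_map (merge_op A) D0 (e_delta total_effect) (inr (fresh A b D0)),
           delay_on b)
     else gval b)); last by move=> b bg; apply: update_gamma; rewrite -dg.
  by rewrite -map_comp dg.
have -> : map (csubst valuation) (body_chr cr) =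
    Delta (chr_store (mrg (merge_op A) D0 (e_delta total_effect))) ::
    map F (abufs ++ [seq b <- bufs | b \notin abufs]).
  rewrite [body_chr _]/= [map (csubst _) _]/= !map_cat -!map_comp.
  congr cons; congr cat.
    apply/eq_in_map => a ain.
    have ab : pat_buffer a.2 \in abufs by apply/mapP; exists a.
    by rewrite -[RHS]/(F (pat_buffer a.2)) /F ab.
  by apply/eq_in_map => b; rewrite mem_filter /F /= => /andP[/negbTE->].
rewrite perm_cons; apply: perm_map; apply: uniq_perm.
- rewrite cat_uniq (uniq_abufs r_ok) filter_uniq ?uniq_sorted_fset // andbT /=.
  by apply/hasPn => b; rewrite mem_filter => /andP[].
- exact: uniq_sorted_fset.
- move=> b; rewrite mem_cat mem_filter mem_sorted_fset.
  by case: (boolP (b \in abufs)) => //= /(sub_abufs r_ok)->.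
Qed.

End Valuation.

(** * Variants and outcome choices *)

Section Renaming.
Context {C Q X : choiceType} {R : realType}.
Implicit Types (rho : X -> X) (r : chr_rule C Q R X).

Lemma tvars_rename rho (t : term C R X) :
  tvars (tsubst (fun x => Var (rho x)) t) = map rho (tvars t).
Proof.
by rewrite tvars_tsubst /= -[RHS]flatten_seq1 -map_comp.
Qed.

Lemma csvars_rename rho (G : seq (constraint C R X)) :
  csvars (map (csubst (fun x => Var (rho x))) G) = map rho (csvars G).
Proof.
rewrite /csvars map_flatten -!map_comp; congr flatten; apply: eq_map.
by case=> [a|a b c] /=; rewrite ?map_cat !tvars_rename.
Qed.

Lemma bsvars_rename rho (B : seq (builtin C Q R X)) :
  bsvars (map (bsubst (fun x => Var (rho x))) B) = map rho (bsvars B).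
Proof.
rewrite /bsvars map_flatten -!map_comp; congr flatten; apply: eq_map.
case=> //= *; rewrite ?map_cat ?tvars_rename // map_flatten -!map_comp.
by congr flatten; apply: eq_map => t /=; rewrite tvars_rename.
Qed.

Lemma rule_vars_rename rho r :
  rule_vars (rename_rule rho r) = map rho (rule_vars r).
Proof. by rewrite /rule_vars /= !map_cat !csvars_rename !bsvars_rename. Qed.

Lemma rename_rule_id r : rename_rule id r = r.
Proof.
have cid G : map (csubst (fun x => Var (id x))) G = G :> seq (constraint C R X).
  by rewrite (eq_map (@csubst_var _ _ _)) map_id.
have bid B : map (bsubst (fun x => Var (id x))) B = B :> seq (builtin C Q R X).
  by rewrite (eq_map (@bsubst_var _ _ _ _)) map_id.
by case: r => k h g b c; rewrite /rename_rule /= !cid !bid.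
Qed.

Lemma map_csubst_rename rho (eta : X -> ground_term C R) G :
  map (csubst eta) (map (csubst (fun x => Var (rho x))) G) =
  map (csubst (eta \o rho)) G.
Proof. by rewrite -map_comp; apply: eq_map => c /=; rewrite csubst_csubst. Qed.

Lemma holds_rename (I : interpretation C Q R) rho
    (eta : X -> ground_term C R) B :
  holds I eta (map (bsubst (fun x => Var (rho x))) B) <->
  holds I (eta \o rho) B.
Proof. exact: holds_map_bsubst. Qed.

(* The variables of a variant that do not occur in its head can be given
   arbitrary values without changing those of the rest of the state. *)
Lemma extend_renamed rho r G B W (eta val : X -> ground_term C R) :
  {in rule_vars r &, injective rho} ->
  renamed_apart (rename_rule rho r) G B W ->
  {in csvars (kept r ++ removed r), eta \o rho =1 val} ->
  exists2 eta' : X -> ground_term C R,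
    {in rule_vars r, eta' \o rho =1 val} &
    {in csvars G ++ bsvars B, eta' =1 eta}.
Proof.
move=> inj ra hd; pose hv := csvars (kept r ++ removed r).
have hvr : {subset hv <= rule_vars r}.
  by move=> x; rewrite /hv csvars_cat /rule_vars !mem_cat => /orP[]->;
    rewrite ?orbT.
pose nh := [seq y <- rule_vars r | y \notin hv].
have nhr : {subset nh <= rule_vars r}.
  by move=> x; rewrite mem_filter => /andP[].
(* [rho] is inverted on the images of non-head variables by looking up their position. *)
exists (fun x => if x \in map rho nh then val (nth x nh (index x (map rho nh)))
                 else eta x).
  move=> y yr /=; case: ifPn => [yn|].
    have iy : index (rho y) (map rho nh) < size nh.
      by rewrite -(size_map rho) index_mem.
    congr val; apply: inj => //; first by apply: nhr; rewrite mem_nth.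
    by rewrite -(nth_map _ (rho y)) // nth_index.
  move=> yn; apply: hd; apply: contraNT yn => yh.
  by apply: map_f; rewrite mem_filter yh.
move=> x; rewrite mem_cat => xGB; case: ifPn => // /mapP[y yn xy].
have yr := nhr _ yn; move: yn; rewrite mem_filter => /andP[yh _].
have [] := ra x; first by rewrite rule_vars_rename xy map_f.
  rewrite /= -map_cat csvars_rename xy; apply: contra yh.
  by case/mapP => z zh e; rewrite (inj y z) // hvr.
by case/orP: xGB => ->.
Qed.

End Renaming.

Lemma Forall2_nth S T (P : S -> T -> Prop) s t x0 y0 :
  List.Forall2 P s t ->
  size s = size t /\ forall i, i < size s -> P (nth x0 s i) (nth y0 t i).
Proof.
elim=> //= x y {}s {}t pxy _ [-> ih]; split=> // -[|i] //= /ih; exact.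
Qed.

(** * Choosing outcomes, and reading a match off a valuation *)

Section Matching.
Context {d : Order.disp_t} {C : orderType d} {V Q : choiceType} {R : realType}.
Local Notation chr_var := (@chr_var d C V).
Local Notation gterm := (ground_term C R).
Variables (A : architecture C Q R).
Implicit Types (sigma : state C Q R) (I : interpretation C Q R).

Lemma instance_chr_of_state I sigma G :
  instance I (chr_of_state sigma : chr_state C Q R chr_var) G <->
  info_holds I (info sigma) /\ perm_eq (ground_goal sigma) G.
Proof.
split=> [[eta hB]|[hu p]]; first by rewrite csubst_goal -(holds_chr_info I eta).
exists (fun=> Nil); first exact/holds_chr_info.
by rewrite csubst_goal.
Qed.

(** Outcomes are prescribed for finitely many calls in one state and picked by the axiom of choice
    elsewhere; the calls being distinct, the prescriptions do not conflict. *)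
Lemma outcome_choice_extending u D g sa es :
  uniq sa -> List.Forall2 (interp_action A (State D g u)) sa es ->
  exists2 out, choice_of_outcomes A u out & [seq out a D g | a <- sa] = es.
Proof.
move=> usa fa; pose e0 : effect C Q R := Effect [fmap] [fmap] fset0.
pose out a D' g' := if [&& D' == D, g' == g & a \in sa]
  then nth e0 es (index a sa)
  else if pselect (exists e, interp_action A (State D' g' u) a e) is left h
  then projT1 (cid h) else e0.
pose a0 : action C C := (Modify, (nil_id A, nil_id A, fset0)).
have := fa; case/(Forall2_nth (head a0 sa) e0).
set x0 := head _ _ => sz hnth; exists out.
  move=> a D' g' _ ex; rewrite /out; case: ifP => [/and3P[/eqP-> /eqP-> asa]|_].
    by have := hnth (index a sa); rewrite index_mem nth_index //; apply.
  by case: pselect => // h; case: (cid h).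
apply: (@eq_from_nth _ e0); rewrite size_map // => i isa.
by rewrite (nth_map x0) // /out !eqxx mem_nth //= index_uniq.
Qed.

Section Rule.
Variables (r : rule C V) (sigma : state C Q R).
Hypotheses (r_ok : actr_rule A r) (sigma_ok : abstract_state A sigma).
Local Notation cr := (chr_of_rule (Q := Q) (R := R) A r).
Local Notation acts := (actions_of r).

(** Substitution leaves buffers unchanged, and different actions of a rule act on different
    buffers. *)
Lemma uniq_subst_actions theta : uniq (map (subst_action theta) acts).
Proof.
rewrite map_inj_in_uniq; first by rewrite /actions_of sort_uniq fset_uniq.
move=> a a' ain a'in [_ e _]; apply: (action_buffer_inj r_ok) => //.
by rewrite /pat_buffer e.
Qed.

(** The head has one delta and one gamma constraint per buffer, as many as the goal of [sigma]; by
    counting, nothing is left for [G]. *)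
Lemma head_match (zeta : chr_var -> gterm) G :
  perm_eq (map (csubst zeta) (removed cr) ++ G) (ground_goal sigma) ->
  G = [::] /\ head_ok A sigma zeta.
Proof.
move=> p; split.
  apply/size0nil; move: (perm_size p).
  rewrite size_cat /= !size_map -[size (graph_of _)](size_map fst) fst_graph_of.
  have -> : domf (gamma sigma) = buffers A by case: sigma_ok.
  by rewrite -[RHS]addn0 => /addnI.
split=> [|b bb].
  apply/eqP; rewrite -mem_ground_goal_delta -(perm_mem p) mem_cat.
  by rewrite /= mem_head.
have : Gamma (Cst b) (zeta (cvar b)) (zeta (dvar b)) \in ground_goal sigma.
  rewrite -(perm_mem p) mem_cat /= inE /= -map_comp.
  by apply/orP; left; apply/mapP; exists b; rewrite ?mem_sorted_fset.
by case/mem_ground_goalP => b' [c [x [[<-] -> -> e]]]; rewrite /buffer_value e.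
Qed.

(** The substitution is read off [zeta]: it matches by the guard. The actions of the body succeed in
    the least model, so their chosen outcomes are genuine effects. *)
Lemma least_model_bindings w out (zeta : chr_var -> gterm) :
  let I := least_model A (info sigma) w out in
  head_ok A sigma zeta ->
  holds I zeta (guard cr) -> holds I zeta (body_builtin cr) ->
  exists2 theta, bindings r sigma theta &
    forall a, a \in acts ->
      interp_action A sigma (subst_action theta a)
        (action_effect sigma theta out a).
Proof.
move=> I hz hg hb.
pose pvars (q : test) : seq V := pmap (fun p : C * (C + V) =>
  if p.2 is inr x then Some x else None) (enum_fset q.2).
pose vs := flatten (map pvars (enum_fset r.1)).
have vsP x : reflect (exists2 q, q \in r.1 & in_vars x q.2) (x \in vs).
  apply: (iffP idP) => [/flatten_mapP[q qr]|[q qr [s sP]]].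
    rewrite mem_pmap => /mapP[[s v] sv]; case: v sv => //= y sP [->].
    by exists q => //; exists s.
  apply/flatten_mapP; exists q => //; rewrite mem_pmap; apply/mapP.
  by exists (s, inr x).
(* The domain is exactly the variables of the tests, whose values every match must share; this makes
   [theta] the smallest match. *)
pose theta : substitution := [fmap x : [fset y in vs] =>
  if zeta (actr_var (val x)) is Cst c then c else nil_id A].
have thetaP x c : theta.[? x] = Some c <->
    x \in vs /\ (if zeta (actr_var x) is Cst c then c else nil_id A) = c.
  have [xv|xv] := boolP (x \in [fset y in vs]).
    rewrite (fnd_fmap_in _ xv) /=; move: xv; rewrite inE /= => ->.
    by split=> [[]|[_ ->]].
  rewrite not_fnd //; move: xv; rewrite inE /= => /negbTE->.
  by split=> // -[].
have thetaE x q s c : q \in r.1 -> (s, inr x) \in q.2 ->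
    zeta (actr_var x) = Cst c -> theta.[? x] = Some c.
  move=> qr sP zx; apply/thetaP; rewrite zx; split=> //.
  by apply/vsP; exists q => //; exists s.
have th : matches theta r sigma.
  move=> b t P tr; have /holds_guard/(_ _ tr) ht := hg.
  have [val [gb Dc] h] := guard_match r_ok sigma_ok hz tr ht.
  exists (buffer_value A sigma b).1, val; split=> // s v sP.
  have [x sx vx] := h s v sP; exists x => //.
  case: v sP vx => [c _ [->]//|y sP /= zy]; exact: thetaE tr sP zy.
have ag := match_agree r_ok sigma_ok hz hg th.
exists theta.
  split=> // theta' th' x c /thetaP[/vsP[q qr xq] <-].
  by have [c' tx ->] := match_agree r_ok sigma_ok hz hg th' qr xq.
case=> [k [[b t] P]] ain; move: hb.
rewrite -[body_builtin cr]/(_ ++ [:: _; _] ++ _) holds_cat holds_map.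
case=> /(_ _ ain) + _.
have tE := tsubst_action_term (Q := Q) (A := A) r_ok ag ain.
have cE := tsubst_cogstate sigma_ok hz.
rewrite [bsubst _ _]/= -[ground_holds _ _]/(i_action I
  (tsubst zeta (ActT k (Cst b) (Cst t) (pattern_term P))) (zeta var_D)
  (tsubst zeta (cogstate_term (buffers A))) (zeta (resstore b))
  (zeta (resid b)) (zeta (resdelay b))).
rewrite tE cE hz.1 /=.
case=> k' [b' [t' [l' [D' [g' [c [x]]]]]]] /= [[]].
move=> /ground_action_term_inj[<- <- <- <-] /chr_store_inj<- /chr_gamma_inj<-.
case=> -[_ ie _] _; rewrite /action_effect subst_action_pairs.
by move: ie; case: (sigma).
Qed.

End Rule.
End Matching.

(** * Steps *)

Section Main.
Context {d : Order.disp_t} {C : orderType d} {V Q : choiceType} {R : realType}.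
Local Notation chr_var := (@chr_var d C V).
Local Notation gterm := (ground_term C R).
Variables (A : architecture C Q R) (M : {fset rule C V}).
Implicit Types (sigma : state C Q R) (I : interpretation C Q R).

Local Notation step out u sigma sigma' :=
  (chr_step (ct_model A u out) (chr_of_model A M)
     (chr_of_state sigma) (chr_of_state sigma')).

(** No constraint occurs twice in a ground goal, as each buffer has one gamma constraint; both sides
    can be compared as sets. *)
Lemma ground_goal_set sigma b c x y :
  (gamma sigma).[? b] = Some (c, x) ->
  perm_eq (Gamma (Cst b) (Cst c) (Num y) ::
           rem (Gamma (Cst b) (Cst c) (Num x)) (ground_goal sigma))
    (ground_goal
       (State (delta sigma) (gamma sigma).[b <- (c, y)] (info sigma))).
Proof.
move=> gb.
have uniq_goal s : uniq (ground_goal s : seq (constraint C R void)).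
  rewrite /ground_goal cons_uniq; apply/andP; split; first by apply/mapP => -[].
  rewrite map_inj_uniq; last by move=> [b1 [c1 r1]] [b2 [c2 r2]] [-> -> ->].
  by apply: (@map_uniq _ _ fst); rewrite fst_graph_of uniq_sorted_fset.
apply: uniq_perm => // [|e].
  rewrite cons_uniq rem_uniq ?uniq_goal // andbT mem_rem_uniq // inE negb_and.
  rewrite mem_ground_goal_gamma gb negbK; case: (eqVneq x y) => [->|xy].
    by rewrite eqxx.
  by apply/orP; right; apply: contra xy => /eqP[->].
rewrite inE mem_rem_uniq // inE; case: e => [t|s1 s2 s3].
  by rewrite !mem_ground_goal_delta /=.
apply/orP/idP => [[/eqP[-> -> ->]|/andP[ne]]|].
- by rewrite mem_ground_goal_gamma /= fnd_set eqxx.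
- case/mem_ground_goalP => b' [c' [x' [e1 e2 e3 gb']]]; subst.
  rewrite mem_ground_goal_gamma /= fnd_set.
  case: (eqVneq b' b) => [eb|_]; last by rewrite gb'.
  by move: ne; subst b'; move: gb'; rewrite gb => -[-> ->]; rewrite eqxx.
- case/mem_ground_goalP => b' [c' [x' [-> -> -> /=]]].
  rewrite fnd_set; case: eqP => [-> [-> ->]|nb gb']; first by left.
  right; rewrite mem_ground_goal_gamma gb' eqxx andbT.
  by apply/eqP => -[/nb].
Qed.

Lemma equiv_chr_of_state (CT : theory (C := C) (Q := Q) (R := R)) sigma
    (eta0 : chr_var -> gterm) G B :
  perm_eq (map (csubst eta0) G) (ground_goal sigma) ->
  (forall I eta, CT I -> holds I eta B ->
     {in csvars G, eta =1 eta0} /\ info_holds I (info sigma)) ->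
  (forall I, CT I -> info_holds I (info sigma) -> holds I eta0 B) ->
  equiv CT (ChrState G B fset0) (chr_of_state sigma).
Proof.
move=> p hB h0.
apply: (EqvTrans (T := ChrState _ (chr_info (info sigma)) _)).
  apply: (equiv_ground (eta0 := eta0)).
  - exact: bsvars_chr_info.
  - by move=> I eta CTI /(hB _ _ CTI)[? ?]; split=> //; apply/holds_chr_info.
  - by move=> I eta CTI /holds_chr_info; apply: h0.
rewrite -[chr_of_state sigma]/(ChrState (goal (chr_of_state sigma))
  (chr_info (info sigma)) fset0) -cground_ground_goal.
by apply: EqvMultiset; apply: perm_map.
Qed.

Lemma no_rule_chr_step sigma sigma' : no_rule_step sigma sigma' ->
  forall out, step out (info sigma) sigma sigma'.
Proof.
move=> [b [c [x [gb x0 ->]]]] out.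
(* The rule is used without renaming: its head variables are bound by equations to the selected
   buffer, chunk and delay, and the rest of the goal stays ground. *)
pose G := map (cground chr_var)
  (rem (Gamma (Cst b) (Cst c) (Num x)) (ground_goal sigma)).
pose eta0 : chr_var -> gterm := fun v =>
  match v with inr 0 => Cst b | inr 1 => Cst c | inr 2 => Num x | _ => Nil end.
pose B := eqns eta0 [:: inr 0; inr 1; inr 2] ++ chr_info (info sigma).
have GE eta : map (csubst eta) G =
    rem (Gamma (Cst b) (Cst c) (Num x)) (ground_goal sigma).
  rewrite /G -map_comp -[RHS]map_id; apply: eq_map => e /=.
  rewrite /cground csubst_csubst -[RHS]csubst_var.
  by apply: eq_in_csubst => -[].
have BE I eta : holds I eta (BGt (Var (inr 2)) (Num 0%R) :: B) <->
    {in [:: inr 0; inr 1; inr 2 : chr_var], eta =1 eta0} /\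
    info_holds I (info sigma).
  rewrite -cat1s /B !holds_cat holds_eqns holds_chr_info.
  split=> [[_ //]|[h hi]]; split=> //=.
  by rewrite h ?inE ?eqxx.
have cE c' : csvars (c' :: G) = cvars c'.
  by rewrite -[LHS]/(cvars c' ++ csvars G) csvars_cground cats0.
exists (ChrState (Gamma (Var (inr 0)) (Var (inr 1)) (Var (inr 2)) :: G)
         (BGt (Var (inr 2)) (Num 0%R) :: B) fset0).
exists (ChrState (Gamma (Var (inr 0)) (Var (inr 1)) (Num 0%R) :: G)
         (BGt (Var (inr 2)) (Num 0%R) :: B) fset0).
split.
- apply: EqvSym; apply: (equiv_chr_of_state (eta0 := eta0)).
  + rewrite map_cons GE /= perm_sym perm_to_rem // mem_ground_goal_gamma gb.
    by rewrite eqxx.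
  + move=> I eta _ /BE[h hi]; split=> // v.
    by rewrite cE => /h.
  + by move=> I _ hi; apply/BE.
- exists (no_chr_rule (V := V)), (no_chr_rule (V := V)), G, B, fset0.
  split=> //.
  + by right.
  + by exists id; rewrite ?rename_rule_id // => v w _ _.
  + move=> v vr /negP[]; move: vr; rewrite /rule_vars /= !inE.
    by do 3!case: (v == inr _).
- apply: (equiv_chr_of_state (eta0 := eta0)).
  + by rewrite map_cons GE; apply: ground_goal_set.
  + move=> I eta _ /BE[h hi]; split=> // v.
    rewrite cE => vin; apply: h; move: vin.
    by rewrite !inE => /orP[]->; rewrite ?orbT.
  + by move=> I _ hi; apply/BE.
Qed.

(** * Valuations of a state equivalent to a translated one *)

Section Semantics.
Variables (CT : theory (C := C) (Q := Q) (R := R)) (I : interpretation C Q R).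
Variables (S : chr_state C Q R chr_var) (sigma : state C Q R).
Hypotheses (CTI : CT I) (eS : equiv CT (chr_of_state sigma) S).

Lemma equiv_satisfiable : info_holds I (info sigma) ->
  exists2 eta, holds I eta (bstore S) &
               perm_eq (map (csubst eta) (goal S)) (ground_goal sigma).
Proof.
by move=> hi; apply/(equiv_instance _ CTI eS)/instance_chr_of_state.
Qed.

Lemma equiv_holds eta : holds I eta (bstore S) ->
  info_holds I (info sigma) /\
  perm_eq (ground_goal sigma) (map (csubst eta) (goal S)).
Proof.
move=> h; apply/instance_chr_of_state/(equiv_instance _ CTI eS).
by exists eta; rewrite ?perm_refl.
Qed.

End Semantics.

Lemma chr_step_no_rule sigma sigma' out S T :
  let CT := ct_model A (info sigma) out in
  rewrites (fun r => r = no_chr_rule (V := V)) S T ->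
  equiv CT (chr_of_state sigma) S -> equiv CT T (chr_of_state sigma') ->
  no_rule_step sigma sigma'.
Proof.
move=> CT [_ [_ [G [B [W [-> [rho _ ->] _ -> ->]]]]]] eS /EqvSym eT.
pose I w := least_model A (info sigma) w out.
have CTI w : CT (I w) by exact: least_model_ct.
(* The body adds no built-ins, so source and target of the rewriting have the same solutions in
   every model. *)
have sub w : info sigma `<=` w -> info sigma' `<=` w.
  move/(info_holds_least_model A (info sigma) w out) => hi.
  have [eta hB _] := equiv_satisfiable (CTI w) eS hi.
  by have [/info_holds_least_model] := equiv_holds (CTI w) eT hB.
(* The model in which exactly the atoms of [info sigma'] hold gives the converse inclusion, and its
   valuation identifies the buffer concerned. *)
have hi' : info_holds (I (info sigma')) (info sigma').
  exact/info_holds_least_model.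
have [eta hB p'] := equiv_satisfiable (CTI _) eT hi'.
have [/info_holds_least_model sub' p] := equiv_holds (CTI _) eS hB.
have infoE : info sigma' = info sigma.
  by apply/eqP; rewrite eqEfsubset sub' sub.
have := p; rewrite perm_sym => /perm_mem/(_ (Gamma (eta (rho (inr 0)))
  (eta (rho (inr 1))) (eta (rho (inr 2))))).
rewrite /= mem_head => /esym/mem_ground_goalP[b [c [x [eb ec ex gb]]]].
have x0 : (0 < x)%R by move: hB => /= [] ; rewrite ex.
exists b, c, x; split=> //.
have [dE gE] : delta sigma' = delta sigma /\
    gamma sigma' = (gamma sigma).[b <- (c, 0%R)].
  have goal_b : Gamma (Cst b) (Cst c) (Num x) \in ground_goal sigma.
    by rewrite mem_ground_goal_gamma gb.
  apply: (@ground_goal_inj _ _ _ _ sigma' (State (delta sigma)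
    (gamma sigma).[b <- (c, 0%R)] (info sigma))).
  apply: perm_trans (ground_goal_set _ gb); rewrite perm_sym in p'.
  apply: perm_trans p' _; rewrite perm_sym in p.
  have := perm_trans p (perm_to_rem goal_b).
  by rewrite /= eb ec ex !perm_cons.
by case: (sigma') dE gE infoE => ? ? ? /= -> -> ->.
Qed.

(** The rewriting starts from the rule head itself, with equations binding its variables to [sigma].
    The guard may be added since [valuation] satisfies it in every model, and [equiv_chr_of_state]
    recognizes both ends. *)
Lemma apply_chr_step r sigma theta out :
  r \in M -> actr_rule A r -> set_normal_form A r -> abstract_state A sigma ->
  matches theta r sigma ->
  (forall a, a \in actions_of r -> interp_action A sigma (subst_action theta a)
                                     (action_effect sigma theta out a)) ->
  let e := total_effect A r sigma theta out in
  (forall b c x, (e_gamma e).[? b] = Some (c, x) ->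
     c = fresh A b (delta sigma) /\ c \in domf (e_delta e)) ->
  step out (info sigma) sigma (update A sigma e).
Proof.
move=> rM r_ok r_snf sigma_ok th eff e kept_ok.
pose cr := chr_of_rule (Q := Q) (R := R) A r.
pose val := valuation A r sigma theta out.
pose B := eqns val (csvars (removed cr)) ++ chr_info (info sigma).
have head_val : head_ok A sigma val by exact: head_ok_valuation.
have BE I eta : holds I eta B <->
    {in csvars (removed cr), eta =1 val} /\ info_holds I (info sigma).
  by rewrite /B holds_cat holds_eqns holds_chr_info.
have val_guard I : holds I val (guard cr).
  exact: (valuation_guard r_ok r_snf sigma_ok out th).
exists (ChrState (removed cr ++ [::]) (guard cr ++ B) fset0).
exists (ChrState (body_chr cr ++ [::])
         (guard cr ++ body_builtin cr ++ B) fset0).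
split.
- apply: EqvSym; rewrite cats0; apply: (equiv_chr_of_state (eta0 := val)).
  + by rewrite (head_goal r sigma_ok head_val).
  + by move=> I eta _ /holds_cat[_ /BE].
  + by move=> I _ hi; apply/holds_cat; split=> //; apply/BE.
- exists cr, cr, [::], B, fset0; split=> //.
  + by left; exists r.
  + by exists id; rewrite ?rename_rule_id // => x y _ _.
  (* The store [B] only mentions head variables, so the rule is apart without renaming. *)
  + move=> x _ xh; split=> //.
    by rewrite /B bsvars_cat bsvars_eqns bsvars_chr_info cats0.
- rewrite cats0; apply: (equiv_chr_of_state (eta0 := val)).
  + exact: (body_goal r_ok sigma_ok eff kept_ok).
  + move=> I eta CTI /holds_cat[hg /holds_cat[hb /BE[hv hi]]].
    have hh : head_ok A sigma eta.
      split; first by rewrite hv // /csvars /= mem_head.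
      move=> b bb; have [xc xd] : cvar b \in csvars (removed cr) /\
          dvar b \in csvars (removed cr).
        have gm : gamma_var b \in removed cr.
          by rewrite inE map_f ?orbT // mem_sorted_fset.
        by split; apply: mem_csvars gm _; rewrite !inE eqxx ?orbT.
      by rewrite !hv //; exact: head_val.2.
    have [he hi'] :=
      valuation_unique r_ok sigma_ok th eff kept_ok CTI hi hh hg hb.
    split; first by move=> x xb; apply: he; rewrite rule_varsE xb !orbT.
    by move=> a; rewrite inE => /orP[/hi|/hi'].
  + move=> I CTI hi.
    have [hi0 hie] : info_holds I (info sigma) /\ info_holds I (e_info e).
      by split=> a ai; apply: hi; rewrite inE ai ?orbT.
    apply/holds_cat; split=> //; apply/holds_cat; split; last exact/BE.
    exact: (valuation_body r_ok sigma_ok th eff kept_ok CTI hi0 hie).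
Qed.

(** One solution of the target in a least model also solves the source, guard and body, which yields
    the match, the effects and the new goal; a second model then bounds the new information from
    above. *)
Lemma chr_step_apply r r' sigma sigma' out G B W :
  let CT := ct_model A (info sigma) out in
  let cr := chr_of_rule (Q := Q) (R := R) A r in
  r \in M -> actr_rule A r -> set_normal_form A r -> abstract_state A sigma ->
  results_kept A M sigma ->
  variant cr r' -> renamed_apart r' G B W ->
  equiv CT (chr_of_state sigma)
    (ChrState (kept r' ++ removed r' ++ G) (guard r' ++ B) W) ->
  equiv CT (ChrState (kept r' ++ body_chr r' ++ G)
              (guard r' ++ body_builtin r' ++ B) W) (chr_of_state sigma') ->
  apply_step A r sigma sigma'.
Proof.
move=> CT cr rM r_ok r_snf sigma_ok kept_ok [rho inj ->] apart eS /EqvSym eT.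
pose I w := least_model A (info sigma) w out.
have CTI w : CT (I w) by exact: least_model_ct.
have headE (eta : chr_var -> gterm) :
    perm_eq (ground_goal sigma) (map (csubst eta)
      (kept (rename_rule rho cr) ++ removed (rename_rule rho cr) ++ G)) ->
    G = [::] /\ head_ok A sigma (eta \o rho).
  have -> : map (csubst eta)
      (kept (rename_rule rho cr) ++ removed (rename_rule rho cr) ++ G) =
      map (csubst (eta \o rho)) (removed cr) ++ map (csubst eta) G.
    rewrite -(map_csubst_rename rho eta (removed cr)).
    exact: (map_cat (csubst eta) (removed (rename_rule rho cr)) G).
  rewrite perm_sym => /(head_match sigma_ok)[/eqP].
  by rewrite -size_eq0 size_map size_eq0 => /eqP.
have hi' : info_holds (I (info sigma')) (info sigma').
  exact/info_holds_least_model.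
have [eta hB p'] := equiv_satisfiable (CTI _) eT hi'.
have [hg hb hB'] : [/\ holds (I (info sigma')) (eta \o rho) (guard cr),
    holds (I (info sigma')) (eta \o rho) (body_builtin cr) &
    holds (I (info sigma')) eta B].
  move: hB => /= /holds_cat[/holds_rename hg /holds_cat[/holds_rename hb hB]].
  by split.
have hT : holds (I (info sigma')) eta (guard (rename_rule rho cr) ++ B).
  by apply/holds_cat; split=> //; apply/holds_rename.
have [hi p] := equiv_holds (CTI _) eS hT.
have [G0 hh] := headE eta p; rewrite {}G0 in p p' eS eT apart headE.
have [theta th eff] := least_model_bindings r_ok sigma_ok hh hg hb.
pose e := total_effect A r sigma theta out.
have ie : interp_rule A r theta sigma e.
  exists (map (action_effect sigma theta out) (actions_of r)) => //.
  have : {subset actions_of r <= actions_of r} by [].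
  elim: {1 3 4}(actions_of r) => /= [|a s ih] sub; first by constructor.
  constructor; first by apply: eff; apply: sub; rewrite mem_head.
  by apply: ih => a' a's; apply: sub; rewrite inE a's orbT.
have e_kept := kept_ok r theta e rM th ie.
pose val := valuation A r sigma theta out.
have [etaE hie] :=
  valuation_unique r_ok sigma_ok th.1 eff e_kept (CTI _) hi hh hg hb.
exists theta, e; split=> //.
have [dE gE] : delta sigma' = delta (update A sigma e) /\
    gamma sigma' = gamma (update A sigma e).
  apply: ground_goal_inj.
  have body := body_goal r_ok sigma_ok eff e_kept.
  apply: perm_trans body; rewrite perm_sym; apply: perm_trans p'.
  have -> : map (csubst val) (body_chr cr) =
            map (csubst (eta \o rho)) (body_chr cr).
    apply: eq_in_map_csubst => x xb; apply/esym/etaE.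
    by rewrite rule_varsE xb !orbT.
  rewrite -(map_csubst_rename rho eta (body_chr cr)).
  by rewrite [goal _](cats0 (body_chr (rename_rule rho cr))).
suff infoE : info sigma' = info (update A sigma e).
  by case: (sigma') dE gE infoE => ? ? ? /= -> -> ->.
(* The updated information holds in the model of [info sigma'], hence is contained in it. *)
apply/eqP; rewrite eqEfsubset; apply/andP; split; last first.
  rewrite fsubUset; apply/andP.
  by split; [move: hi|move: hie] => /info_holds_least_model.
(* For the other inclusion the model has exactly the updated information. The source has a solution
   there; being renamed apart, the variant allows it to be extended by [val] to a solution of the
   target, so [info sigma'] holds as well. *)
pose w := info sigma `|` e_info e.
have [hiw hiew] : info_holds (I w) (info sigma) /\ info_holds (I w) (e_info e).
  by split; apply/info_holds_least_model; rewrite ?fsubsetUl ?fsubsetUr.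
have [eta2 hB2 p2] := equiv_satisfiable (CTI w) eS hiw.
rewrite perm_sym in p2; have [_ hh2] := headE _ p2.
have [|eta3 val3 ext3] := extend_renamed (val := val) inj apart (eta := eta2).
  move=> x; rewrite [_ ++ _]/= => /(mem_head_vars (r := r))[->|[b bb [->|->]]].
  - exact: hh2.1.
  - by have [] := hh2.2 b bb.
  - by have [] := hh2.2 b bb.
have hB3 : holds (I w) eta3
    (guard (rename_rule rho cr) ++ body_builtin (rename_rule rho cr) ++ B).
  have ext F : {subset bsvars F <= rule_vars cr} -> holds (I w) val F ->
      holds (I w) eta3 (map (bsubst (fun x => Var (rho x))) F).
    move=> sub hF; apply/holds_rename; apply: eq_in_holds hF => x xF.
    by rewrite val3 // sub.
  apply/holds_cat; split; last (apply/holds_cat; split).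
  - apply: ext; first by move=> x xg; rewrite rule_varsE xg !orbT.
    exact: (valuation_guard r_ok r_snf sigma_ok out th.1).
  - apply: ext; first by move=> x xg; rewrite rule_varsE xg !orbT.
    exact: (valuation_body r_ok sigma_ok th.1 eff e_kept (CTI w) hiw hiew).
  - have /holds_cat[_ hBw] := hB2.
    by apply: eq_in_holds hBw => x xB; rewrite ext3 // mem_cat xB orbT.
by have [/info_holds_least_model] := equiv_holds (CTI w) eT hB3.
Qed.

End Main.

(** An ACT-R step may use any outcome of an action, while a theory fixes one; from left to right the
    choice is built around the outcomes of the given step. *)
Theorem mainTheorem1 (d : Order.disp_t) (C : orderType d) (V Q : choiceType)
  (R : realType) (A : architecture C Q R) (M : {fset rule C V})
  (sigma sigma' : state C Q R) :
  (forall r, r \in M -> actr_rule A r /\ set_normal_form A r) ->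
  abstract_state A sigma ->
  abstract_state A sigma' ->
  results_kept A M sigma ->
  actr_step A M sigma sigma' <->
  exists2 out, choice_of_outcomes A (info sigma) out &
    chr_step (ct_model A (info sigma) out) (chr_of_model A M)
      (chr_of_state sigma) (chr_of_state sigma').
Proof.
move=> M_ok sigma_ok _ kept_ok; split.
  case=> [[r rM [theta [e [th [es fa eE] ->]]]]|no]; last first.
    (* A no-rule step prescribes no outcome, so the empty list is extended to a choice. *)
    have [out out_ok _] := outcome_choice_extending (isT : uniq [::])
      (List.Forall2_nil (interp_action A
         (State (delta sigma) (gamma sigma) (info sigma)))).
    by exists out => //; apply: no_rule_chr_step.
  have [r_ok r_snf] := M_ok r rM.
  have sE : sigma = State (delta sigma) (gamma sigma) (info sigma).
    by case: (sigma).
  have fa' : List.Forall2 (interp_action A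
      (State (delta sigma) (gamma sigma) (info sigma)))
      (map (subst_action theta) (actions_of r)) es by rewrite -sE.
  have [out out_ok outE] :=
    outcome_choice_extending (uniq_subst_actions r_ok theta) fa'.
  exists out => //; subst e; rewrite -outE -map_comp.
  have eff_ok a : a \in actions_of r -> interp_action A sigma
      (subst_action theta a) (action_effect sigma theta out a).
    move=> ain; rewrite {1}sE; apply: out_ok; first by rewrite -sE.
    have [sz h] := Forall2_nth (subst_action theta a)
      (Effect [fmap] [fmap] fset0) fa'.
    have ia : subst_action theta a \in map (subst_action theta) (actions_of r).
      exact: map_f.
    have := h (index (subst_action theta a)
      (map (subst_action theta) (actions_of r))).
    rewrite index_mem nth_index // => /(_ ia) ?.
    by eexists; eassumption.
  have outE' : map (action_effect sigma theta out) (actions_of r) = es.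
    by rewrite -outE -map_comp.
  rewrite -[combine_all A _]/(total_effect A r sigma theta out).
  have kept b c x := kept_ok r theta _ rM th
    (ex_intro2 _ _ es fa erefl) b c x.
  rewrite -outE' -/(total_effect A r sigma theta out) in kept.
  exact: apply_chr_step rM r_ok r_snf sigma_ok th.1 eff_ok kept.
case=> out _ [S [T [eS [r0 [r' [G [B [W [Pr hv ha SE TE]]]]]] eT]]].
case: Pr hv => [[r rM ->]|r0E] hv.
  left; exists r => //; have [r_ok r_snf] := M_ok r rM.
  rewrite SE in eS; rewrite TE in eT.
  exact: chr_step_apply rM r_ok r_snf sigma_ok kept_ok hv ha eS eT.
by right; apply: chr_step_no_rule eS eT; exists r0, r', G, B, W.
Qed.
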